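(* Let $K\subseteq\mathbb{R}^d$ be a compact, smooth $d$-manifold with boundary and let $\nu$ be a probability measure on $\mathbb{R}^d$ with density $f$ whose support is $K$ and with $\inf_{x\in K} f(x)>0$. There are constants $c_1=c_1(K,\nu)$ and $c_2=c_2(K)$ such that, for any sequence $(r_n)$ with $c_1\left(\frac{\ln n}{n}\right)^{1/d}\leq r_n\leq c_2$, the geometric realization of $\mathcal{R}(n,r_n)$ is asymptotically almost surely homotopy equivalent to $K$.
   Context: $K\subseteq\mathbb{R}^d$ being a smooth $d$-manifold with boundary means: for every $x\in K$ there are open sets $O,U\subseteq\mathbb{R}^d$ with $x\in O$ and a diffeomorphism $\varphi:O\to U$ with $\varphi[O\cap K]=U\cap\mathbb{H}^d$, where $\mathbb{H}^d=[0,\infty)\times\mathbb{R}^{d-1}$. The random Vietoris--Rips complex $\mathcal{R}(n,r)$ is constructed by sampling $X_1,\dots,X_n$ i.i.d. according to $\nu$ and declaring a subset of these points a simplex if and only if all its pairwise Euclidean distances (in $\mathbb{R}^d$) are at most $r$. A sequence of events $E_n$ holds asymptotically almost surely (a.a.s.) if $\Pr(E_n)\to 1$. *)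

(* Defs.v *)
From HB Require Import structures.
From mathcomp Require Import all_boot all_order all_algebra.
From mathcomp Require Import all_classical all_reals all_analysis.
Set Implicit Arguments. Unset Strict Implicit. Unset Printing Implicit Defensive.
Import Order.TTheory GRing.Theory Num.Theory.
Import numFieldNormedType.Exports.
Local Open Scope classical_set_scope.
Local Open Scope ring_scope.

Section Defs.
Variable R : realType.

Definition borelRd (d : nat) := g_sigma_algebraType (@open 'rV[R]_d).

Definition edist (d : nat) (x y : 'rV[R]_d) : R :=
  Num.sqrt (\sum_(i < d) (x ord0 i - y ord0 i) ^+ 2).

Fixpoint iter_deriv (d : nat) (vs : seq 'rV[R]_d) (f : 'rV[R]_d -> 'rV[R]_d)
  : 'rV[R]_d -> 'rV[R]_d :=
  match vs with
  | [::] => f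
  | v :: vs' => fun x => 'D_v (iter_deriv vs' f) x
  end.

Definition smooth_on (d : nat) (O : set 'rV[R]_d) (f : 'rV[R]_d -> 'rV[R]_d) :=
  forall (vs : seq 'rV[R]_d), forall x, O x ->
    (forall v, derivable (iter_deriv vs f) x v) /\
    {for x, continuous (iter_deriv vs f)}.

Definition diffeo_between (d : nat) (O U : set 'rV[R]_d)
  (phi : 'rV[R]_d -> 'rV[R]_d) :=
  exists psi : 'rV[R]_d -> 'rV[R]_d,
    [/\ phi @` O `<=` U, psi @` U `<=` O,
        (forall x, O x -> psi (phi x) = x),
        (forall y, U y -> phi (psi y) = y) &
        smooth_on O phi /\ smooth_on U psi].

Definition halfspace (d : nat) : set 'rV[R]_d :=
  [set y | forall i : 'I_d, (i : nat) = 0%N -> 0 <= y ord0 i].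

Definition smooth_manifold_with_boundary (d : nat) (K : set 'rV[R]_d) :=
  forall x, K x -> exists (O U : set 'rV[R]_d) (phi : 'rV[R]_d -> 'rV[R]_d),
    [/\ open O, open U, O x, diffeo_between O U phi &
        phi @` (O `&` K) = U `&` (@halfspace d)].

Definition is_lebesgue_measure (d : nat)
  (lam : {measure set (borelRd d) -> \bar R}) :=
  forall a b : 'rV[R]_d, (forall i, a ord0 i <= b ord0 i) ->
    lam [set x : 'rV[R]_d | forall i, a ord0 i <= x ord0 i <= b ord0 i]
    = (\prod_(i < d) (b ord0 i - a ord0 i))%:E.

Definition rips_simplex (d n : nat) (p : 'I_n -> 'rV[R]_d) (r : R)
  (s : {set 'I_n}) : bool :=
  (0 < #|s|)%N && [forall i in s, forall j in s, edist (p i) (p j) <= r].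

(* geometric realization inside R^n (barycentric coordinates) *)
Definition rips_realization (d n : nat) (p : 'I_n -> 'rV[R]_d) (r : R)
  : set 'rV[R]_n :=
  [set t | (forall i, 0 <= t ord0 i) /\ \sum_(i < n) t ord0 i = 1 /\
           rips_simplex p r [set i | t ord0 i != 0]].

Definition homotopy_equivalent (m k : nat) (A : set 'rV[R]_m)
  (B : set 'rV[R]_k) :=
  exists (f : 'rV[R]_m -> 'rV[R]_k) (g : 'rV[R]_k -> 'rV[R]_m)
         (H : R * 'rV[R]_m -> 'rV[R]_m) (G : R * 'rV[R]_k -> 'rV[R]_k),
  [/\ f @` A `<=` B /\ g @` B `<=` A,
      {within A, continuous f}, {within B, continuous g},
      [/\ {within `[0, 1] `*` A, continuous H},
          H @` (`[0, 1] `*` A) `<=` A,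
          (forall x, A x -> H (0, x) = g (f x)) &
          (forall x, A x -> H (1, x) = x)] &
      [/\ {within `[0, 1] `*` B, continuous G},
          G @` (`[0, 1] `*` B) `<=` B,
          (forall y, B y -> G (0, y) = f (g y)) &
          (forall y, B y -> G (1, y) = y)]].

Definition iid_with_law (d : nat) (dO : measure_display) (O : measurableType dO)
  (P : probability O R) (X : nat -> O -> 'rV[R]_d)
  (nu : probability (borelRd d) R) :=
  (forall i, measurable_fun setT (X i : O -> borelRd d)) /\
  forall (n : nat) (B : nat -> set (borelRd d)),
    (forall i, measurable (B i)) ->
    P (\bigcap_(i in `I_n) (X i @^-1` B i)) = (\prod_(i < n) nu (B i))%E.

(* asymptotically almost surely (inner probability, so no measurability
   assumption on the events is needed) *)
Definition aas (dO : measure_display) (O : measurableType dO)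
  (P : probability O R) (E : nat -> set O) :=
  exists A : nat -> set O, (forall n, measurable (A n) /\ A n `<=` E n) /\
    (P (A n) @[n --> \oo] --> 1%E).

End Defs.

(* Main.v *)
(* For small r the convex hulls of the simplices of the Rips complex stay
   within o(r) of K, because the boundary of K is C^1.  The map to K
   sends a point t of the complex with vertices p_i to its barycenter
   y = sum t_i p_i, pushed into K along a continuous inward vector field; the
   map back is given by a partition of unity.  On K the composite is homotopic
   to the identity by a straight line followed by relaxing the push.  On the
   complex one cannot join t directly to points near y, since vertices of the
   simplex at distance about r from y may be present.  With
   q_i = |p_i - y|^2 and W = sum t_i q_i, multiply each t_i by
   max(0, r^2/2 + W - q_i).  The total mass stays at least r^2/2, because the
   t-average of r^2/2 + W - q_i is r^2/2; and as the diameter bound gives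
   q_i + W <= r^2, every surviving vertex has q_i <= 3/4 r^2.  This leaves room
   for a linear homotopy to points near y.
   The sample is dense enough with high probability by a union bound over the
   cells of a cubical grid that are contained in K: the inward field yields
   such a cell near every point of K. *)
Require Import Defs.
From HB Require Import structures.
From mathcomp Require Import all_boot all_order all_algebra.
From mathcomp Require Import all_classical all_reals all_analysis.
From mathcomp Require Import measurable_realfun ring lra.
Import Order.TTheory GRing.Theory Num.Theory.
Import numFieldNormedType.Exports.
Local Open Scope classical_set_scope.
Local Open Scope ring_scope.

Set Implicit Arguments.
Unset Strict Implicit.
Unset Printing Implicit Defensive.

(** * Row vectors and squared distances *)

(** The norm of a row vector is the sup norm; only [edist] and [sqdist] are Euclidean. *)
Lemma rV_normP (R : realType) (m : nat) (x : 'rV[R]_m) (e : R) :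
  0 <= e -> reflect (forall i, `|x ord0 i| <= e) (`|x| <= e).
Proof.
move=> e0; rewrite /Num.Def.normr /= mx_normrE.
apply: (iffP idP) => [/bigmax_leP[_ xe] i|xe].
  exact: (xe (ord0, i)).
by apply/bigmax_leP; split=> // -[a i] _ /=; rewrite (ord1 a); exact: xe.
Qed.

Lemma ler_coord_norm (R : realType) (m : nat) (x : 'rV[R]_m) i :
  `|x ord0 i| <= `|x|.
Proof. by have h := rV_normP x (normr_ge0 x); move: i; apply/h. Qed.

Lemma cvg_rV (R : realType) (T : Type) (F : set_system T) (m : nat)
    (f : T -> 'rV[R]_m) (a : 'rV[R]_m) {FF : Filter F} :
  (forall i, f z ord0 i @[z --> F] --> a ord0 i) -> f @ F --> a.
Proof.
move=> fa.
rewrite [X in X @ _ --> _](_ : _ = fun z => \sum_i f z ord0 i *: delta_mx 0 i).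
  rewrite [X in _ --> X]row_sum_delta.
  apply: cvg_big; first exact: add_continuous.
  by move=> i _; apply: cvgZ => //; exact: cvg_cst.
by apply/funext => z; exact: row_sum_delta.
Qed.

Lemma cvg_coord (R : realType) (T : Type) (F : set_system T) (m : nat)
    (f : T -> 'rV[R]_m) (a : 'rV[R]_m) i {FF : Filter F} :
  f @ F --> a -> f z ord0 i @[z --> F] --> a ord0 i.
Proof.
move=> fa.
exact: (cvg_comp _ _ fa (@coord_continuous _ _ _ _ _ a)).
Qed.

Lemma cvg_sumr (R : realType) (V : normedModType R) (T : Type) (F : set_system T)
    (I : Type) (s : seq I)
    (f : I -> T -> V) (a : I -> V) {FF : Filter F} :
  (forall i, f i z @[z --> F] --> a i) ->
  \sum_(i <- s) f i z @[z --> F] --> \sum_(i <- s) a i.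
Proof. by move=> fa; apply: cvg_big => //; exact: add_continuous. Qed.

Lemma cvg_maxr (R : realType) (T : Type) (F : set_system T) (f g : T -> R) (a b : R)
  {FF : Filter F} : f @ F --> a -> g @ F --> b ->
  Num.max (f z) (g z) @[z --> F] --> Num.max a b.
Proof.
move=> fa gb.
have e (x y : R) : Num.max x y = 2^-1 * (x + y + `|x - y|).
  by case: (ler0P (x - y)) => h; [rewrite max_r ?max_l|rewrite max_l]; lra.
rewrite e (_ : (fun _ => _) = fun z => 2^-1 * (f z + g z + `|f z - g z|));
  last by apply/funext => z.
apply: cvgM; first exact: cvg_cst.
apply: cvgD; first exact: cvgD.
by apply: cvg_norm; exact: cvgB.
Qed.

Definition sqdist (R : realType) (d : nat) (x y : 'rV[R]_d) : R :=
  \sum_(i < d) (x ord0 i - y ord0 i) ^+ 2.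

Lemma sqdistC (R : realType) (d : nat) (x y : 'rV[R]_d) : sqdist x y = sqdist y x.
Proof. by apply: eq_bigr => i _; rewrite -sqrrN opprB. Qed.

Lemma edist_leE (R : realType) (d : nat) (x y : 'rV[R]_d) (r : R) : 0 <= r ->
  (Defs.edist x y <= r) = (sqdist x y <= r ^+ 2).
Proof.
move=> r0; rewrite /Defs.edist -/(sqdist x y) -{1}(ger0_norm r0) -sqrtr_sqr.
by rewrite ler_sqrt // sqr_ge0.
Qed.

Lemma sqdist_le_norm (R : realType) (d : nat) (x y : 'rV[R]_d) (e : R) :
  `|x - y| <= e -> sqdist x y <= d%:R * e ^+ 2.
Proof.
move=> xye; rewrite /sqdist -[X in X%:R * _](card_ord d) mulr_natl -sumr_const.
apply: ler_sum => i _; rewrite -real_normK ?num_real // lerXn2r ?nnegrE //.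
  exact: le_trans xye.
by have := ler_coord_norm (x - y) i; rewrite !mxE => /le_trans; exact.
Qed.

Lemma norm_le_edist (R : realType) (d : nat) (x y : 'rV[R]_d) :
  `|x - y| <= Defs.edist x y.
Proof.
apply/rV_normP => [|i]; first exact: sqrtr_ge0.
rewrite !mxE -sqrtr_sqr ler_wsqrtr //.
by rewrite (bigD1 i) //= lerDl sumr_ge0 // => j _; exact: sqr_ge0.
Qed.

(** Young's inequality with parameter 1/6. The weights are tuned to 7/6 * 3/4 = 7/8: a vertex with
    squared distance at most 3/4 r^2 from [y] leaves r^2/8 for the second term. *)
Lemma sqdist_add_le (R : realType) (d : nat) (x y z : 'rV[R]_d) :
  sqdist x z <= 7 / 6 * sqdist x y + 7 * sqdist y z.
Proof.
rewrite /sqdist !mulr_sumr -big_split; apply: ler_sum => i _ /=.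
set a := x _ _; set b := y _ _; set c := z _ _.
(* The gap between the two sides is one sixth of this square. *)
have := sqr_ge0 (a - b - 6 * (b - c)); nra.
Qed.

(** * Crushing simplices towards their barycenter *)

Section RipsToSpace.
Variables (R : realType) (d n : nat) (p : 'I_n -> 'rV[R]_d).
Implicit Types (t : 'rV[R]_n) (r e : R) (x : 'rV[R]_d).

Definition barycenter t : 'rV[R]_d := \sum_(i < n) t ord0 i *: p i.

Definition weighted_sqdist t : R :=
  \sum_(i < n) t ord0 i * sqdist (p i) (barycenter t).

Lemma barycenter_coord t j :
  barycenter t ord0 j = \sum_(i < n) t ord0 i * p i ord0 j.
Proof. by rewrite summxE; apply: eq_bigr => i _; rewrite mxE. Qed.

Lemma barycenter_dist_le t x e : (forall i, 0 <= t ord0 i) ->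
  \sum_(i < n) t ord0 i = 1 ->
  (forall i, t ord0 i != 0 -> `|p i - x| <= e) -> `|barycenter t - x| <= e.
Proof.
move=> t0 t1 pe.
rewrite -[x in X in X <= _]scale1r -t1 scaler_suml -sumrB.
rewrite (le_trans (ler_norm_sum _ _ _))//.
rewrite -[e]mul1r -t1 mulr_suml; apply: ler_sum => i _.
rewrite -scalerBr normrZ ger0_norm //.
have [->|ti] := eqVneq (t ord0 i) 0; first by rewrite !mul0r.
by rewrite ler_wpM2l // pe.
Qed.

(* Huygens' parallel axis identity *)
Lemma sum_sqdist_barycenter t x : \sum_(i < n) t ord0 i = 1 ->
  \sum_(i < n) t ord0 i * sqdist (p i) x =
  weighted_sqdist t + sqdist x (barycenter t).
Proof.
move=> t1; set y := barycenter t.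
(* Expand the square about y; the cross terms cancel in the sum because y is the barycenter. *)
have e i : t ord0 i * sqdist (p i) x = t ord0 i * sqdist (p i) y +
    t ord0 i * sqdist x y + \sum_j 2 * (y ord0 j - x ord0 j) *
      (t ord0 i * (p i ord0 j - y ord0 j)).
  rewrite /sqdist !mulr_sumr -!big_split; apply: eq_bigr => j _ /=; ring.
rewrite (eq_bigr _ (fun i _ => e i)) !big_split /= -mulr_suml t1 mul1r.
rewrite exchange_big /= [X in _ + X]big1 ?addr0 // => j _.
rewrite -mulr_sumr; under eq_bigr do rewrite mulrBr.
by rewrite sumrB -barycenter_coord -mulr_suml t1 mul1r subrr mulr0.
Qed.

(** By the parallel axis identity at p_k, the left side is the t-average of the |p_i - p_k|^2, each
    at most r^2. *)
Lemma rips_sqdist_barycenter t r k : 0 <= r -> rips_realization p r t ->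
  t ord0 k != 0 ->
  sqdist (p k) (barycenter t) + weighted_sqdist t <= r ^+ 2.
Proof.
move=> r0 [t0 [t1 /andP[_ /forallP st]]] tk.
rewrite addrC -sum_sqdist_barycenter // -[r ^+ 2]mul1r -t1 mulr_suml.
apply: ler_sum => i _; have [->|ti] := eqVneq (t ord0 i) 0.
  by rewrite !mul0r.
have := implyP (st i); rewrite inE ti => /(_ erefl)/forallP/(_ k).
by rewrite inE tk /= edist_leE // => h; rewrite ler_wpM2l.
Qed.

Definition crush_weight r t i : R :=
  Num.max 0 (r ^+ 2 / 2 + weighted_sqdist t - sqdist (p i) (barycenter t)).

Definition crush_mass r t : R := \sum_(i < n) t ord0 i * crush_weight r t i.

(* The weights of vertices far from the barycenter are cut off, so that the
   remaining simplex can be joined to points near the barycenter. *)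
Definition crush r t : 'rV[R]_n :=
  \row_i (t ord0 i * crush_weight r t i / crush_mass r t).

Lemma crush_mass_gt0 r t : 0 < r -> (forall i, 0 <= t ord0 i) ->
  \sum_(i < n) t ord0 i = 1 -> 0 < crush_mass r t.
Proof.
move=> r0 t0 t1; apply: (@lt_le_trans _ _ (r ^+ 2 / 2)).
  by rewrite divr_gt0 // exprn_gt0.
have -> : r ^+ 2 / 2 = \sum_(i < n) t ord0 i *
    (r ^+ 2 / 2 + weighted_sqdist t - sqdist (p i) (barycenter t)).
  under eq_bigr do rewrite mulrBr.
  by rewrite sumrB -/(weighted_sqdist t) -mulr_suml t1 mul1r addrK.
by apply: ler_sum => i _; rewrite ler_wpM2l // /crush_weight le_max lexx orbT.
Qed.

Lemma crush_ge0 r t i : 0 < r -> (forall i, 0 <= t ord0 i) ->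
  \sum_(i < n) t ord0 i = 1 -> 0 <= crush r t ord0 i.
Proof.
move=> r0 t0 t1; rewrite mxE divr_ge0 //; last exact/ltW/crush_mass_gt0.
by rewrite mulr_ge0 // le_max lexx.
Qed.

Lemma crush_sum r t : 0 < r -> (forall i, 0 <= t ord0 i) ->
  \sum_(i < n) t ord0 i = 1 -> \sum_(i < n) crush r t ord0 i = 1.
Proof.
move=> r0 t0 t1; under eq_bigr do rewrite mxE.
by rewrite -mulr_suml divff // gt_eqF // crush_mass_gt0.
Qed.

Lemma crush_neq0 r t i : crush r t ord0 i != 0 ->
  t ord0 i != 0 /\
  sqdist (p i) (barycenter t) <= r ^+ 2 / 2 + weighted_sqdist t.
Proof.
rewrite mxE => h; split.
  by apply: contraNneq h => ->; rewrite !mul0r.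
rewrite leNgt; apply: contra_neqN h => h.
by rewrite /crush_weight max_l ?mulr0 ?mul0r // subr_le0 ltW.
Qed.

(** Adding the cut-off bound q <= r^2/2 + W to q + W <= r^2 eliminates W and leaves 2 q <= 3/2
    r^2. *)
Lemma crush_near_barycenter r t i : 0 < r -> rips_realization p r t ->
  crush r t ord0 i != 0 ->
  sqdist (p i) (barycenter t) <= 3 / 4 * r ^+ 2.
Proof.
move=> r0 tr /crush_neq0[ti h1].
have h2 := rips_sqdist_barycenter (ltW r0) tr ti; lra.
Qed.

(** Continuity is stated along an arbitrary filter, so that it serves both the maps on points and
    the homotopies on pairs of a time and a point. *)
Lemma cvg_barycenter (T : Type) (F : set_system T) {FF : Filter F}
    (h : T -> 'rV[R]_n) t :
  h @ F --> t -> barycenter (h z) @[z --> F] --> barycenter t.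
Proof.
move=> ht; apply: cvg_sumr => i; apply: cvgZ; last exact: cvg_cst.
exact: cvg_coord.
Qed.

Lemma cvg_sqdist_barycenter (T : Type) (F : set_system T) {FF : Filter F}
    (h : T -> 'rV[R]_n) t i : h @ F --> t ->
  sqdist (p i) (barycenter (h z)) @[z --> F] --> sqdist (p i) (barycenter t).
Proof.
move=> ht; apply: cvg_sumr => j.
have hj : p i ord0 j - barycenter (h z) ord0 j @[z --> F] -->
    p i ord0 j - barycenter t ord0 j.
  by apply: cvgB; [exact: cvg_cst|apply: cvg_coord; exact: cvg_barycenter].
by rewrite expr2; apply: cvgM.
Qed.

(** Only the limit [t] has to lie in the simplex: a positive mass there is enough for the quotient
    to converge. *)
Lemma cvg_crush (T : Type) (F : set_system T) {FF : Filter F}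
    (h : T -> 'rV[R]_n) r t : 0 < r -> (forall i, 0 <= t ord0 i) ->
  \sum_(i < n) t ord0 i = 1 ->
  h @ F --> t -> crush r (h z) @[z --> F] --> crush r t.
Proof.
move=> r0 t0 t1 ht.
have cc j : h z ord0 j @[z --> F] --> t ord0 j by exact: cvg_coord.
have cv : weighted_sqdist (h z) @[z --> F] --> weighted_sqdist t.
  by apply: cvg_sumr => i; apply: cvgM => //; exact: cvg_sqdist_barycenter.
have cw i : h z ord0 i * crush_weight r (h z) i @[z --> F] -->
    t ord0 i * crush_weight r t i.
  apply: cvgM => //; apply: cvg_maxr; first exact: cvg_cst.
  apply: cvgB; last exact: cvg_sqdist_barycenter.
  by apply: cvgD => //; exact: cvg_cst.
apply: cvg_rV => i; rewrite mxE; under eq_fun do rewrite mxE.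
apply: cvgM => //; apply: cvgV; last exact: cvg_sumr.
by rewrite gt_eqF // crush_mass_gt0.
Qed.

End RipsToSpace.

(** * The homotopy equivalence *)

Lemma mem_rips (R : realType) (d n : nat) (p : 'I_n -> 'rV[R]_d) (r : R)
    (t : 'rV[R]_n) : 0 <= r ->
  (forall i, 0 <= t ord0 i) -> \sum_(i < n) t ord0 i = 1 ->
  (forall i j, t ord0 i != 0 -> t ord0 j != 0 -> sqdist (p i) (p j) <= r ^+ 2) ->
  rips_realization p r t.
Proof.
move=> r0 t0 t1 st; split=> //; split=> //; apply/andP; split.
  (* Weights of sum 1 cannot all vanish, so the support is nonempty. *)
  apply/card_gt0P; apply/not_existsP => tz.
  move/eqP: t1; rewrite big1 ?(eq_sym 0) ?oner_eq0 // => i _.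
  by have := tz i; rewrite inE => /negP; rewrite negbK => /eqP.
apply/forallP => i; apply/implyP; rewrite inE => ti.
apply/forallP => j; apply/implyP; rewrite inE => tj.
by rewrite edist_leE // st.
Qed.

(** The support of a convex combination lies in the union of the two supports, so distances within
    each and across suffice. Both phases of the homotopy on the complex are such segments. *)
Lemma rips_segment (R : realType) (d n : nat) (p : 'I_n -> 'rV[R]_d) (r a : R)
    (t u : 'rV[R]_n) : 0 <= r -> 0 <= a <= 1 ->
  (forall i, 0 <= t ord0 i) -> \sum_(i < n) t ord0 i = 1 ->
  (forall i, 0 <= u ord0 i) -> \sum_(i < n) u ord0 i = 1 ->
  (forall i j, t ord0 i != 0 -> t ord0 j != 0 -> sqdist (p i) (p j) <= r ^+ 2) ->
  (forall i j, u ord0 i != 0 -> u ord0 j != 0 -> sqdist (p i) (p j) <= r ^+ 2) ->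
  (forall i j, t ord0 i != 0 -> u ord0 j != 0 -> sqdist (p i) (p j) <= r ^+ 2) ->
  rips_realization p r (a *: t + (1 - a) *: u).
Proof.
move=> r0 /andP[a0 a1] t0 t1 u0 u1 tt uu tu; apply: mem_rips => //.
- by move=> i; rewrite !mxE addr_ge0 // mulr_ge0 // subr_ge0.
- under eq_bigr do rewrite !mxE.
  by rewrite big_split -!mulr_sumr /= t1 u1 !mulr1 addrC subrK.
have supp i : (a *: t + (1 - a) *: u) ord0 i != 0 ->
    t ord0 i != 0 \/ u ord0 i != 0.
  rewrite !mxE => h; have [ti|] := eqVneq (t ord0 i) 0; [right|by left].
  by apply: contraNneq h => ->; rewrite ti !mulr0 addr0.
move=> i j /supp[] hi /supp[] hj; [exact: tt|exact: tu| |exact: uu].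
by rewrite sqdistC; exact: tu.
Qed.

(** * Partition of unity by tent functions around the sample points *)

Section PartitionOfUnity.
Variables (R : realType) (d n : nat) (p : 'I_n -> 'rV[R]_d) (e : R).
Implicit Types (x : 'rV[R]_d).

Definition bump x i : R := Num.max 0 (e - `|x - p i|).

Definition bump_coord x : 'rV[R]_n := \row_i (bump x i / \sum_j bump x j).

Lemma bump_ge0 x i : 0 <= bump x i.
Proof. by rewrite le_max lexx. Qed.

Lemma bump_sum_gt0 x : (exists i, `|x - p i| < e) -> 0 < \sum_j bump x j.
Proof.
move=> [i xi]; rewrite (bigD1 i) //= ltr_wpDr ?sumr_ge0 // => [j _|].
  exact: bump_ge0.
by rewrite lt_max subr_gt0 xi orbT.
Qed.

Lemma bump_coord_ge0 x i : 0 <= bump_coord x ord0 i.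
Proof. by rewrite mxE divr_ge0 ?bump_ge0 ?sumr_ge0 // => j _; exact: bump_ge0. Qed.

Lemma bump_coord_sum x : (exists i, `|x - p i| < e) ->
  \sum_(i < n) bump_coord x ord0 i = 1.
Proof.
move=> /bump_sum_gt0 xe; under eq_bigr do rewrite mxE.
by rewrite -mulr_suml divff // gt_eqF.
Qed.

Lemma bump_coord_neq0 x i : bump_coord x ord0 i != 0 -> `|x - p i| <= e.
Proof.
rewrite mxE; apply: contra_neqT; rewrite -ltNge => h.
by rewrite /bump max_l ?mul0r // subr_le0 ltW.
Qed.

Lemma cvg_bump_coord (T : Type) (F : set_system T) {FF : Filter F}
    (h : T -> 'rV[R]_d) x : (exists i, `|x - p i| < e) ->
  h @ F --> x -> bump_coord (h z) @[z --> F] --> bump_coord x.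
Proof.
move=> xe hx.
have cb i : bump (h z) i @[z --> F] --> bump x i.
  apply: cvg_maxr; first exact: cvg_cst.
  apply: cvgB; first exact: cvg_cst.
  by apply: cvg_norm; apply: cvgB => //; exact: cvg_cst.
apply: cvg_rV => i; rewrite mxE; under eq_fun do rewrite mxE.
apply: cvgM => //; apply: cvgV; last exact: cvg_sumr.
by rewrite gt_eqF // bump_sum_gt0.
Qed.

End PartitionOfUnity.

(** * Clocks for homotopies in two stages *)

Section TwoPhases.
Variable R : realType.
Implicit Types s : R.

(** [phase1] falls from 1 to 0 on the first half of the unit interval, [phase2] rises from 0 to 1 on
    the second half, and at every time one of them is 0. Homotopies in two stages thus become single
    formulas, with no gluing of continuous pieces. *)
Definition phase1 s : R := Num.max 0 (1 - 2 * s).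
Definition phase2 s : R := Num.max 0 (2 * s - 1).

Lemma phases s : 0 <= s <= 1 ->
  (phase2 s = 0 /\ 0 <= phase1 s <= 1) \/ (phase1 s = 0 /\ 0 <= phase2 s <= 1).
Proof.
move=> /andP[s0 s1]; rewrite /phase1 /phase2; have [h|h] := leP s 2^-1; [left|right].
  by rewrite max_l ?max_r; try split; try (apply/andP; split); lra.
by rewrite max_l ?max_r; try split; try (apply/andP; split); lra.
Qed.

Lemma phase1_0 : phase1 0 = 1. Proof. by rewrite /phase1 max_r; lra. Qed.
Lemma phase1_1 : phase1 1 = 0. Proof. by rewrite /phase1 max_l; lra. Qed.
Lemma phase2_0 : phase2 0 = 0. Proof. by rewrite /phase2 max_l; lra. Qed.
Lemma phase2_1 : phase2 1 = 1. Proof. by rewrite /phase2 max_r; lra. Qed.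

Lemma cvg_phase1 (T : Type) (F : set_system T) {FF : Filter F} (h : T -> R) s :
  h @ F --> s -> phase1 (h z) @[z --> F] --> phase1 s.
Proof.
move=> hs; apply: cvg_maxr; first exact: cvg_cst.
apply: cvgB; first exact: cvg_cst.
by apply: cvgM => //; exact: cvg_cst.
Qed.

Lemma cvg_phase2 (T : Type) (F : set_system T) {FF : Filter F} (h : T -> R) s :
  h @ F --> s -> phase2 (h z) @[z --> F] --> phase2 s.
Proof.
move=> hs; apply: cvg_maxr; first exact: cvg_cst.
apply: cvgB; last exact: cvg_cst.
by apply: cvgM => //; exact: cvg_cst.
Qed.

End TwoPhases.

(** * The explicit homotopies, for a fixed sample *)

Section RipsEquivalence.
Variables (R : realType) (d n : nat) (K : set 'rV[R]_d) (p : 'I_n -> 'rV[R]_d).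
Variables (v : 'rV[R]_d -> 'rV[R]_d) (r e s g M : R).
Hypotheses (d0 : (0 < d)%N) (r0 : 0 < r) (s0 : 0 <= s) (e0 : 0 <= e).
Hypothesis v_cont : continuous v.
Hypothesis v_bnd : forall y, `|v y| <= M.
(** Times shorter than [s] are included because the homotopy on [K] ends by relaxing the push to
    time 0. [K_hull] and [e_small] bring barycenters of simplices, and the straight-line homotopy on
    [K], within reach of the full push. *)
Hypothesis v_push : forall x y s', 0 <= s' <= s -> K x -> `|y - x| <= g * s' ->
  K (y + s' *: v y).
Hypothesis K_hull : forall t, rips_realization p r t ->
  exists2 x, K x & `|barycenter p t - x| <= g * s.
Hypothesis p_dense : forall x, K x -> exists i, `|x - p i| < e.
Hypothesis e_small : e <= g * s.
Hypothesis r_large : 8 * d%:R * (e + s * M) <= r.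

Let push (y : 'rV[R]_d) : 'rV[R]_d := y + s *: v y.
Let rips_to_K (t : 'rV[R]_n) : 'rV[R]_d := push (barycenter p t).

(** With w = e + s M, the passage from sup norm to Euclidean distance gives 7 |y - x|^2 <= 7 d w^2
    <= 7 (d w)^2 <= 7/64 r^2. *)
Let near_small (x y z : 'rV[R]_d) : `|x - z| <= e -> `|z - y| <= s * M ->
  7 * sqdist y x <= r ^+ 2 / 8.
Proof.
move=> xz zy; have yx : `|y - x| <= e + s * M.
  rewrite distrC -(subrK z x) -addrA (le_trans (ler_normD _ _)) //.
  exact: lerD.
have d1 : 1 <= d%:R :> R by rewrite ler1n.
have h0 : 0 <= e + s * M by exact: le_trans yx.
have := sqdist_le_norm yx; have : (8 * d%:R * (e + s * M)) ^+ 2 <= r ^+ 2.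
  by rewrite ler_sqr ?nnegrE ?(ltW r0) ?mulr_ge0.
set w := e + s * M in h0 *; set D : R := d%:R in d1 *.
have : 0 <= w ^+ 2 by exact: sqr_ge0.
have : D * w ^+ 2 <= (D * w) ^+ 2.
  by rewrite exprMn ler_wpM2r ?sqr_ge0 // expr2 ler_peMl // (le_trans _ d1).
rewrite !exprMn; nra.
Qed.

Let push_near y : `|push y - y| <= s * M.
Proof. by rewrite addrC addKr normrZ ger0_norm // ler_wpM2l. Qed.

Let rips_to_K_in t : rips_realization p r t -> K (rips_to_K t).
Proof.
by move=> /K_hull[x Kx yx]; apply: (v_push _ Kx) => //; rewrite s0 lexx.
Qed.

Let K_to_rips := bump_coord p e.

Let bump_crush_near t i : K_to_rips (rips_to_K t) ord0 i != 0 ->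
  7 * sqdist (barycenter p t) (p i) <= r ^+ 2 / 8.
Proof.
move=> /bump_coord_neq0 h; apply: (near_small (z := rips_to_K t)).
  by rewrite distrC.
exact: push_near.
Qed.

Let bump_diam x i j : K_to_rips x ord0 i != 0 -> K_to_rips x ord0 j != 0 ->
  sqdist (p i) (p j) <= r ^+ 2.
Proof.
have M0 : 0 <= M by exact: le_trans (v_bnd 0).
move=> /bump_coord_neq0 hi /bump_coord_neq0 hj.
have near k : `|x - p k| <= e -> 7 * sqdist x (p k) <= r ^+ 2 / 8.
  move=> hk; apply: (near_small (z := x)); first by rewrite distrC.
  by rewrite subrr normr0 mulr_ge0.
have := near _ hi; have := near _ hj; have := sqdist_add_le (p i) x (p j).
rewrite (sqdistC (p i) x); have := sqr_ge0 r; lra.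
Qed.

(** From the round trip through [K] to the identity by way of [crush]: at half time both phases
    vanish and only the crushed point remains. *)
Let homotopy_rips (z : R * 'rV[R]_n) : 'rV[R]_n :=
  phase1 z.1 *: K_to_rips (rips_to_K z.2) +
  ((1 - phase1 z.1 - phase2 z.1) *: crush p r z.2 + phase2 z.1 *: z.2).

(** First the base point y slides to x under the full push; then y = x and the push time shrinks to
    0. *)
Let homotopy_K (z : R * 'rV[R]_d) : 'rV[R]_d :=
  let y := z.2 + phase1 z.1 *: (barycenter p (K_to_rips z.2) - z.2) in
  y + (s * (1 - phase2 z.1)) *: v y.

Let homotopy_rips_in u t : 0 <= u <= 1 -> rips_realization p r t ->
  rips_realization p r (homotopy_rips (u, t)).
Proof.
move=> u01 tr; have [t0 [t1 _]] := tr.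
have ft := p_dense (rips_to_K_in tr).
have tdiam i j : t ord0 i != 0 -> t ord0 j != 0 -> sqdist (p i) (p j) <= r ^+ 2.
  move: tr => [_ [_ /andP[_ /forallP st]]] ti tj.
  have := implyP (st i); rewrite inE ti => /(_ erefl)/forallP/(_ j).
  by rewrite inE tj /= edist_leE // ltW.
have crush_diam i j : crush p r t ord0 i != 0 -> t ord0 j != 0 ->
    sqdist (p i) (p j) <= r ^+ 2.
  by move=> /crush_neq0[ti _] tj; exact: tdiam.
rewrite /homotopy_rips /=; have [[-> a01]|[-> c01]] := phases u01.
- rewrite subr0 scale0r addr0; apply: rips_segment => //; first exact: ltW.
  + by move=> i; exact: bump_coord_ge0.
  + exact: bump_coord_sum.
  + by move=> i; exact: crush_ge0.
  + exact: crush_sum.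
  + exact: bump_diam.
  + by move=> i j hi /crush_neq0[+ _]; exact: crush_diam.
  (* The crucial distance: a surviving vertex and a sample point near the pushed barycenter satisfy
     7/6 * 3/4 r^2 + r^2/8 = r^2. *)
  + move=> i j /bump_crush_near hi /(crush_near_barycenter r0 tr) hj.
    have := sqdist_add_le (p j) (barycenter p t) (p i).
    rewrite (sqdistC (p j) (p i)); lra.
(* Crushing does not enlarge the support, so the second stage stays in the simplex of [t]. *)
- rewrite subr0 scale0r add0r addrC; apply: rips_segment => //; first exact: ltW.
  + by move=> i; exact: crush_ge0.
  + exact: crush_sum.
  + by move=> i j hi /crush_neq0[+ _]; exact: crush_diam.
  + by move=> i j ti /crush_neq0[tj _]; exact: tdiam.
Qed.

Let homotopy_K_in u x : 0 <= u <= 1 -> K x -> K (homotopy_K (u, x)).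
Proof.
move=> u01 Kx; rewrite /homotopy_K /=; have xe := p_dense Kx.
have [[-> /andP[a0 a1]]|[-> /andP[c0 c1]]] := phases u01.
(* Here y is on the segment from x to a barycenter of sample points within [e] of x. *)
- apply: (v_push _ Kx); first by rewrite subr0 mulr1 s0 lexx.
  rewrite addrC addKr normrZ ger0_norm // subr0 mulr1.
  apply: le_trans e_small; apply: (@le_trans _ _ (1 * e)); last by rewrite mul1r.
  apply: ler_pM => //; apply: barycenter_dist_le.
  + by move=> i; exact: bump_coord_ge0.
  + exact: bump_coord_sum.
  + by move=> i /bump_coord_neq0; rewrite distrC.
- rewrite scale0r addr0; apply: (v_push _ Kx).
    by rewrite mulr_ge0 ?subr_ge0 //= ler_piMr // gerBl.
  by rewrite subrr normr0 mulrA mulr_ge0 ?subr_ge0 // (le_trans e0).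
Qed.

Let cvg_rips_to_K (T : Type) (F : set_system T) {FF : Filter F}
    (h : T -> 'rV[R]_n) t :
  h @ F --> t -> rips_to_K (h z) @[z --> F] --> rips_to_K t.
Proof.
move=> ht.
have hb : barycenter p (h z) @[z --> F] --> barycenter p t.
  exact: cvg_barycenter.
have hv : v (barycenter p (h z)) @[z --> F] --> v (barycenter p t).
  exact: (cvg_comp _ _ hb (@v_cont _)).
exact: (cvgD hb (cvgZ (cvg_cst s) hv)).
Qed.

Let cvg_homotopy_rips (T : Type) (F : set_system T) {FF : Filter F}
    (a : T -> R) (h : T -> 'rV[R]_n) u t : rips_realization p r t ->
  a @ F --> u -> h @ F --> t ->
  homotopy_rips (a z, h z) @[z --> F] --> homotopy_rips (u, t).
Proof.
move=> tr cu ct; have [t0 [t1 _]] := tr.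
have c1 : phase1 (a z) @[z --> F] --> phase1 u by exact: cvg_phase1.
have c2 : phase2 (a z) @[z --> F] --> phase2 u by exact: cvg_phase2.
have cg : K_to_rips (rips_to_K (h z)) @[z --> F] --> K_to_rips (rips_to_K t).
  apply: cvg_bump_coord; first exact/p_dense/rips_to_K_in.
  exact: cvg_rips_to_K.
have cc : crush p r (h z) @[z --> F] --> crush p r t by exact: cvg_crush.
have ca : 1 - phase1 (a z) - phase2 (a z) @[z --> F] --> 1 - phase1 u - phase2 u.
  by apply: cvgB => //; apply: cvgB => //; exact: cvg_cst.
exact: (cvgD (cvgZ c1 cg) (cvgD (cvgZ ca cc) (cvgZ c2 ct))).
Qed.

Let cvg_homotopy_K (T : Type) (F : set_system T) {FF : Filter F}
    (a : T -> R) (h : T -> 'rV[R]_d) u x : K x ->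
  a @ F --> u -> h @ F --> x ->
  homotopy_K (a z, h z) @[z --> F] --> homotopy_K (u, x).
Proof.
move=> Kx cu cx.
have c1 : phase1 (a z) @[z --> F] --> phase1 u by exact: cvg_phase1.
have c2 : phase2 (a z) @[z --> F] --> phase2 u by exact: cvg_phase2.
have cg : K_to_rips (h z) @[z --> F] --> K_to_rips x.
  by apply: cvg_bump_coord => //; exact: p_dense.
have cb : barycenter p (K_to_rips (h z)) @[z --> F] -->
    barycenter p (K_to_rips x) by exact: cvg_barycenter.
pose y z := z.2 + phase1 z.1 *: (barycenter p (K_to_rips z.2) - z.2).
have cy : y (a z, h z) @[z --> F] --> y (u, x).
  exact: (cvgD cx (cvgZ c1 (cvgB cb cx))).
have cv : v (y (a z, h z)) @[z --> F] --> v (y (u, x)).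
  exact: (cvg_comp _ _ cy (@v_cont _)).
have ca : s * (1 - phase2 (a z)) @[z --> F] --> s * (1 - phase2 u).
  by apply: cvgM; [exact: cvg_cst|apply: cvgB => //; exact: cvg_cst].
exact: (cvgD cy (cvgZ ca cv)).
Qed.

Lemma rips_homotopy_equivalent : homotopy_equivalent (rips_realization p r) K.
Proof.
exists rips_to_K, K_to_rips, homotopy_rips, homotopy_K; split.
- split=> _ [x hx <-]; first exact: rips_to_K_in.
  apply: mem_rips; [exact: ltW| | |exact: bump_diam].
    by move=> i; exact: bump_coord_ge0.
  exact: bump_coord_sum (p_dense hx).
- apply: continuous_in_subspaceT => t _.
  exact (@cvg_rips_to_K _ _ (nbhs_filter t) id t cvg_id).
- apply: continuous_in_subspaceT => x /set_mem Kx.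
  exact (@cvg_bump_coord _ _ _ _ _ _ _ (nbhs_filter x) id x (p_dense Kx) cvg_id).
- split.
  + apply: continuous_in_subspaceT => -[u t] /set_mem[/= _ tr].
    exact: (@cvg_homotopy_rips _ _ (nbhs_filter (u, t)) fst snd u t tr
      cvg_fst cvg_snd).
  + move=> _ [[u t] [/= u01 tr] <-]; exact: homotopy_rips_in.
  + move=> t _; rewrite /homotopy_rips /= phase1_0 phase2_0.
    by rewrite scale1r subrr subr0 !scale0r !addr0.
  + move=> t _; rewrite /homotopy_rips /= phase1_1 phase2_1.
    by rewrite scale1r subr0 subrr !scale0r !add0r.
- split.
  + apply: continuous_in_subspaceT => -[u x] /set_mem[/= _ Kx].
    exact: (@cvg_homotopy_K _ _ (nbhs_filter (u, x)) fst snd u x Kx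
      cvg_fst cvg_snd).
  + move=> _ [[u x] [/= u01 Kx] <-]; exact: homotopy_K_in.
  + move=> x _; rewrite /homotopy_K /= phase1_0 phase2_0.
    by rewrite scale1r subr0 mulr1 [x + _]addrC subrK.
  + move=> x _; rewrite /homotopy_K /= phase1_1 phase2_1.
    by rewrite subrr mulr0 !scale0r !addr0.
Qed.

End RipsEquivalence.

(** * Strict differentiability *)

Lemma rV_norm_ltP (R : realType) (m : nat) (x : 'rV[R]_m) (e : R) :
  0 < e -> reflect (forall i, `|x ord0 i| < e) (`|x| < e).
Proof.
move=> e0; rewrite /Num.Def.normr /= mx_normrE.
apply: (iffP idP) => [/bigmax_ltP[_ xe] i|xe].
  exact: (xe (ord0, i)).
by apply/bigmax_ltP; split=> // -[a i] _ /=; rewrite (ord1 a); exact: xe.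
Qed.

Definition dot (R : realType) (d : nat) (l z : 'rV[R]_d) : R :=
  \sum_(i < d) l ord0 i * z ord0 i.

Lemma dotD (R : realType) (d : nat) (l z w : 'rV[R]_d) :
  dot l (z + w) = dot l z + dot l w.
Proof. by rewrite -big_split; apply: eq_bigr => i _; rewrite mxE mulrDr. Qed.

Lemma dotZ (R : realType) (d : nat) (l z : 'rV[R]_d) a :
  dot l (a *: z) = a * dot l z.
Proof. by rewrite mulr_sumr; apply: eq_bigr => i _; rewrite mxE mulrCA. Qed.

Lemma dotB (R : realType) (d : nat) (l z w : 'rV[R]_d) :
  dot l (z - w) = dot l z - dot l w.
Proof. by rewrite -[in LHS]scaleN1r dotD dotZ mulN1r. Qed.

Lemma dot_le (R : realType) (d : nat) (l z : 'rV[R]_d) :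
  `|dot l z| <= (\sum_(i < d) `|l ord0 i|) * `|z|.
Proof.
rewrite (le_trans (ler_norm_sum _ _ _)) // mulr_suml.
by apply: ler_sum => i _; rewrite normrM ler_wpM2l // ler_coord_norm.
Qed.

Lemma cvg_dot (R : realType) (d : nat) (T : Type) (F : set_system T)
    {FF : Filter F} (h : T -> 'rV[R]_d) (l z : 'rV[R]_d) :
  h @ F --> z -> dot l (h t) @[t --> F] --> dot l z.
Proof.
move=> hz; apply: cvg_sumr => i; apply: cvgM; first exact: cvg_cst.
exact: cvg_coord.
Qed.

(** One linear form controls the increments between all pairs of points near x. Differentiability at
    x alone would not do, since the increments below start at other points of [K] and at
    barycenters. *)
Definition strict_diff (R : realType) (d : nat) (f : 'rV[R]_d -> R)
    (x l : 'rV[R]_d) :=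
  forall eta, 0 < eta -> exists2 rho, 0 < rho &
    forall a b, `|a - x| < rho -> `|b - x| < rho ->
      `|f b - f a - dot l (b - a)| <= eta * `|b - a|.

Section StrictDifferentiability.
Variables (R : realType) (d : nat).
Implicit Types (f : 'rV[R]_d -> R) (a v x : 'rV[R]_d).

Lemma is_derive_line f a v (u : R) df : is_derive (a + u *: v) v f df ->
  is_derive u 1 (fun u => f (a + u *: v)) df.
Proof.
move=> [dv ev].
have e : (fun h : R => h^-1 *: (((fun u => f (a + u *: v)) \o shift u) (h *: 1) -
    f (a + u *: v))) =
    (fun h => h^-1 *: ((f \o shift (a + u *: v)) (h *: v) - f (a + u *: v))).
  apply/funext => h /=; congr (_ *: (f _ - _)).
  by rewrite scalerDl [h *: 1]mulr1 addrCA.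
by split; [rewrite /derivable e|rewrite /derive e].
Qed.

Lemma line_increment_ge0 f (df : 'rV[R]_d -> R) a v (l eta s : R) : 0 <= s ->
  (forall u, 0 <= u <= s -> is_derive (a + u *: v) v f (df (a + u *: v)) /\
     `|df (a + u *: v) - l| <= eta) ->
  `|f (a + s *: v) - f a - l * s| <= eta * s.
Proof.
move=> s0 H.
have dg u : 0 <= u <= s ->
    is_derive u 1 (fun u => f (a + u *: v)) (df (a + u *: v)).
  by move=> us; apply: is_derive_line; exact: (H _ us).1.
have dg' u : u \in `]0, s[ ->
    is_derive u 1 (fun u => f (a + u *: v)) (df (a + u *: v)).
  by rewrite in_itv /= => /andP[/ltW u0 /ltW us]; apply: dg; rewrite u0 us.
have [|c] := MVT_segment s0 dg'.
  apply: derivable_within_continuous => u; rewrite in_itv /= => us.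
  by have [] := dg _ us.
rewrite in_itv /= => cs; rewrite scale0r addr0 subr0 => ->.
by rewrite -mulrBl normrM (ger0_norm s0) ler_wpM2r //; exact: (H _ cs).2.
Qed.

(** For negative s, traverse the segment from its other end. *)
Lemma line_increment f (df : 'rV[R]_d -> R) a v (l eta s : R) :
  (forall u, 0 <= u <= s \/ s <= u <= 0 ->
     is_derive (a + u *: v) v f (df (a + u *: v)) /\
     `|df (a + u *: v) - l| <= eta) ->
  `|f (a + s *: v) - f a - l * s| <= eta * `|s|.
Proof.
move=> H; have [s0|s0] := leP 0 s.
  rewrite (ger0_norm s0); apply: (line_increment_ge0 (df := df)) => // u us.
  by apply: H; left.
have := @line_increment_ge0 f df (a + s *: v) v l eta (- s).
rewrite scaleNr addrK (ltr0_norm s0) oppr_ge0 (ltW s0) => /(_ isT) h.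
have -> : f (a + s *: v) - f a - l * s = - (f a - f (a + s *: v) - l * - s).
  by ring.
rewrite normrN.
apply: h => u /andP[u0 us]; rewrite -addrA -scalerDl; apply: H; right.
by apply/andP; split; lra.
Qed.

(** Walk from a to b changing one coordinate at a time, and apply the mean value theorem to each
    edge of the path. *)
Lemma C1_strict_diff f x (df : 'I_d -> 'rV[R]_d -> R) :
  (\forall y \near x, forall i, is_derive y (delta_mx ord0 i) f (df i y)) ->
  (forall i, df i y @[y --> x] --> df i x) ->
  strict_diff f x (\row_i df i x).
Proof.
move=> dfx cdf eta eta0.
(* The d edges share the error eta; d + 1 keeps the quotient meaningful for d = 0. *)
have e0 : 0 < eta / d.+1%:R by rewrite divr_gt0.
have : \forall y \near x, forall i,
    is_derive y (delta_mx ord0 i) f (df i y) /\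
    `|df i y - df i x| <= eta / d.+1%:R.
  near=> y => i; split; first by move: i; near: y.
  rewrite distrC; move: i; near: y; apply: filter_forall => i.
  by move/cvgrPdist_le: (cdf i); exact.
move=> /nbhs_normP[rho /= rho0 near_x].
exists rho => // a b ax bx.
pose path k : 'rV[R]_d := \row_j (if (j < k)%N then b ord0 j else a ord0 j).
have path0 : path 0%N = a by apply/rowP => j; rewrite mxE.
have pathd : path d = b by apply/rowP => j; rewrite mxE ltn_ord.
have pathS (k : 'I_d) :
    path k.+1 = path k + (b ord0 k - a ord0 k) *: delta_mx ord0 k.
  apply/rowP => j; rewrite !mxE eqxx /= ltnS leq_eqVlt -val_eqE /=.
  case: eqP => [/val_inj->|_] /=; last by rewrite mulr0 addr0.
  by rewrite ltnn mulr1 addrC subrK.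
have step (k : 'I_d) :
    `|f (path k.+1) - f (path k) - df k x * (b ord0 k - a ord0 k)| <=
    eta / d.+1%:R * `|b - a|.
  rewrite pathS; apply: (@le_trans _ _ (eta / d.+1%:R * `|b ord0 k - a ord0 k|)).
    (* A sup-norm ball is a box, so the edges of the path do not leave it. *)
    apply: (line_increment (df := df k)) => u us; apply: near_x.
    rewrite /ball_ /= distrC; apply/rV_norm_ltP => // j; rewrite !mxE eqxx /=.
    have aj : `|a ord0 j - x ord0 j| < rho.
      by move/(rV_norm_ltP _ rho0): ax => /(_ j); rewrite !mxE.
    have bj : `|b ord0 j - x ord0 j| < rho.
      by move/(rV_norm_ltP _ rho0): bx => /(_ j); rewrite !mxE.
    case: (eqVneq j k) aj bj => [->|_ aj bj]; last first.
      by rewrite mulr0 addr0; case: ifP.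
    rewrite ltnn mulr1 !ltr_norml => /andP[? ?] /andP[? ?].
    by case: us => /andP[? ?]; apply/andP; split; lra.
  rewrite (ler_wpM2l (ltW e0)) //.
  by have := ler_coord_norm (b - a) k; rewrite !mxE.
have -> : f b - f a = \sum_(k < d) (f (path k.+1) - f (path k)).
  rewrite -(big_mkord xpredT (fun k => f (path k.+1) - f (path k))).
  by rewrite (telescope_sumr (f \o path)) //= pathd path0.
rewrite /dot -sumrB (le_trans (ler_norm_sum _ _ _)) //.
apply: (@le_trans _ _ (\sum_(k < d) eta / d.+1%:R * `|b - a|)).
  by apply: ler_sum => k _; rewrite !mxE; exact: step.
rewrite sumr_const card_ord -[leLHS]mulr_natl mulrA ler_wpM2r //.
by rewrite mulrCA ger_pMr // ler_pdivrMr // mul1r ler_nat.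
Unshelve. all: by end_near. Qed.

End StrictDifferentiability.

(** * Local equations of the manifold *)

(** The condition [dot l v = 1] says that the gradient l is nonzero and names a direction of unit
    slope. Interior and boundary points are treated alike, as f x may be positive. *)
Definition local_equation (R : realType) (d : nat) (K : set 'rV[R]_d)
    (x : 'rV[R]_d) (f : 'rV[R]_d -> R) :=
  exists l v : 'rV[R]_d,
    [/\ strict_diff f x l, dot l v = 1 & \forall y \near x, K y <-> 0 <= f y].

Section LocalEquation.
Variables (R : realType) (d : nat) (K : set 'rV[R]_d).
Implicit Types (x y z v : 'rV[R]_d).

(** The chain rule along c: the form l applied to the difference quotients of c tends to its value
    at v by continuity, and to 1 because f grows at unit speed along c. *)
Lemma right_inverse_direction (f : 'rV[R]_d -> R) x l (c : R -> 'rV[R]_d) v :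
  strict_diff f x l -> c 0 = x ->
  (s^-1 *: (c s - c 0)) @[s --> 0^'] --> v ->
  (c s @[s --> 0^'] --> x) ->
  (\forall s \near 0^', f (c s) = f x + s) -> dot l v = 1.
Proof.
move=> fx c0 cv cc fc.
have h1 : dot l (s^-1 *: (c s - c 0)) @[s --> 0^'] --> dot l v by exact: cvg_dot.
suff h2 : dot l (s^-1 *: (c s - c 0)) @[s --> 0^'] --> (1 : R).
  by apply: (cvg_unique _ h1 h2).
apply/cvgrPdist_le => e e0.
(* The difference quotients of c are eventually bounded by |v| + 1, so the total error is at most
   e. *)
have eta0 : 0 < e / (`|v| + 1) by rewrite divr_gt0 // ltr_wpDl.
have [rho rho0 H] := fx _ eta0.
have bv : \forall s \near 0^', `|s^-1 *: (c s - c 0)| <= `|v| + 1.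
  have /cvgrPdist_le/(_ _ (@ltr01 R)) :
      `|s^-1 *: (c s - c 0)| @[s --> 0^'] --> `|v| by exact: cvg_norm.
  apply: filterS => s /=.
  by rewrite ler_norml => /andP[h _]; lra.
have bc : \forall s \near 0^', `|c s - x| < rho.
  move/cvgrPdist_lt: cc => /(_ _ rho0); apply: filterS => s.
  by rewrite distrC.
near=> s.
have s0 : s != 0 by near: s; exact: nbhs_dnbhs_neq.
have hs : `|c s - x| < rho by near: s.
have xx : `|x - x| < rho by rewrite subrr normr0.
have := H x (c s) xx hs.
have -> : f (c s) = f x + s by near: s.
rewrite [f x + s]addrC addrK => h.
rewrite dotZ c0 -[1](mulVf s0) -mulrBr normrM.
have sp : 0 < `|s^-1| by rewrite normr_gt0 invr_eq0.
apply: (@le_trans _ _ (`|s^-1| * (e / (`|v| + 1) * `|c s - x|))).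
  by rewrite ler_wpM2l.
have : `|s^-1 *: (c s - c 0)| <= `|v| + 1 by near: s.
rewrite normrZ c0 => h'.
rewrite mulrCA -[leRHS](@divfK _ (`|v| + 1)) ?gt_eqF ?ltr_wpDl //.
by rewrite ler_wpM2l // ltW.
Unshelve. all: by end_near. Qed.

(** Take for f the first coordinate of a chart [phi], and for v the derivative of the inverse chart
    in that coordinate direction. *)
Lemma manifold_local_equation x : (0 < d)%N -> smooth_manifold_with_boundary K ->
  K x -> exists f, local_equation K x f.
Proof.
move=> d0 hK Kx.
have [V [U [phi [Oo Uo Ox [psi]]]]] := hK _ Kx.
move=> [phiOU psiUO phiK psiK [sphi spsi]] phiOK.
pose i0 := Ordinal d0; pose f y := phi y ord0 i0.
pose e (i : 'I_d) : 'rV[R]_d := delta_mx ord0 i.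
pose df i y := 'D_(e i) phi y ord0 i0.
have Ux : U (phi x) by apply: phiOU; exists x.
have nO : \forall y \near x, V y by exact: open_nbhs_nbhs.
have nU : \forall y \near phi x, U y by exact: open_nbhs_nbhs.
have fx : strict_diff f x (\row_i df i x).
  apply: C1_strict_diff.
    apply: filterS nO => y Oy i.
    have dphi := (sphi [::] y Oy).1 (e i).
    split; first exact: (derivable_mxP phi y (e i)).1.
    by rewrite /df derive_mx // mxE.
  move=> i; have ci := (sphi [:: e i] x Ox).2.
  exact: (@cvg_coord _ _ _ _ ('D_(e i) phi) _ i0 (nbhs_filter x) ci).
exists f, (\row_i df i x), ('D_(e i0) psi (phi x)); split=> //.
- have dpsi := (spsi [::] _ Ux).1 (e i0).
  have cl (F : set_system R) : Filter F -> F --> (0 : R) ->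
      s *: e i0 + phi x @[s --> F] --> phi x.
    move=> FF F0.
    have h1 : s *: e i0 @[s --> F] --> 0 *: e i0.
      by apply: cvgZ => //; exact: cvg_cst.
    have h2 : phi x @[s --> F] --> phi x by exact: cvg_cst.
    have : s *: e i0 + phi x @[s --> F] --> 0 *: e i0 + phi x by exact: cvgD.
    by rewrite scale0r add0r.
  have cl' : s *: e i0 + phi x @[s --> (0:R)^'] --> phi x.
    by apply: cl; exact: nbhs_dnbhs.
  apply: (@right_inverse_direction f x _ (fun s => psi (s *: e i0 + phi x))).
  + exact: fx.
  + by rewrite scale0r add0r phiK.
  + by rewrite scale0r add0r; exact: dpsi.
  + rewrite -[X in _ --> X](phiK _ Ox).
    exact: (cvg_comp _ _ cl' (spsi [::] _ Ux).2).
  + apply: (@filterS R (0:R)^' _ _ _ _ (cl' _ nU)) => s /= Us.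
    by rewrite /f psiK // !mxE !eqxx mulr1 addrC.
- apply: filterS nO => y Oy; split=> [Ky|fy].
    have : (U `&` @halfspace R d) (phi y) by rewrite -phiOK; exists y.
    by move=> [_]; exact.
  (* The point of V and K with image phi y is y itself, by injectivity of [phi] on V. *)
  have : (phi @` (V `&` K)) (phi y).
    rewrite phiOK; split; first by apply: phiOU; exists y.
    by move=> i i00; rewrite (_ : i = i0) //; exact: val_inj.
  by move=> [y' [Oy' Ky'] yy']; rewrite -(phiK _ Oy) -yy' phiK.
Qed.

(** A step s (v + u) raises the linear part of f by at least s (1 - L g) >= s/2, and the error of
    strict differentiability is at most eta s (|v| + 1) = s/2. So f does not drop below f y >= 0. *)
Lemma local_cone x f : local_equation K x f ->
  exists v (g rho : R), [/\ 0 < g, 0 < rho & forall y u s, K y ->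
    `|y - x| < rho -> 0 <= s <= rho -> `|u| <= g -> K (y + s *: (v + u))].
Proof.
move=> [l [v [fx lv /nbhs_normP[rho1 /= rho10 near_x]]]].
set L := \sum_(i < d) `|l ord0 i|.
have L0 : 0 <= L by apply: sumr_ge0.
pose g : R := (2 * (L + 1))^-1.
have g0 : 0 < g by rewrite invr_gt0 mulr_gt0 // ltr_wpDl.
have gL : g * (2 * (L + 1)) = 1 by rewrite mulVf // gt_eqF // mulr_gt0 // ltr_wpDl.
have v0 : 0 <= `|v| by [].
pose eta : R := (2 * (`|v| + 1))^-1.
have eta0 : 0 < eta by rewrite invr_gt0 mulr_gt0 // ltr_wpDl.
have etaE : eta * (2 * (`|v| + 1)) = 1.
  by rewrite mulVf // gt_eqF // mulr_gt0 // ltr_wpDl.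
have [rho2 rho20 H] := fx _ eta0.
pose r := Num.min rho1 rho2.
have r0 : 0 < r by rewrite lt_min rho10.
(* Start and end of the step stay in the r-ball: the end is at distance less than q (|v| + 2), where
   q (|v| + 3) = r. *)
exists v, g, (r / (`|v| + 3)); split => //; first by rewrite divr_gt0 // ltr_wpDl.
move=> y u s Ky yx /andP[s0 sr] ug.
have rE : r / (`|v| + 3) * (`|v| + 3) = r by rewrite divfK // gt_eqF // ltr_wpDl.
move: (r / _) sr yx rE => q sq yx qE.
have q0 : 0 < q by exact: le_lt_trans yx.
have vu : `|v + u| <= `|v| + g by rewrite (le_trans (ler_normD _ _)) // lerD2l.
have g1 : g <= 1 by nra.
have svu : `|s *: (v + u)| <= s * (`|v| + g).
  by rewrite normrZ (ger0_norm s0) ler_wpM2l.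
have bx : `|y + s *: (v + u) - x| < r.
  rewrite addrAC (le_lt_trans (ler_normD _ _)) //.
  have : s * (`|v| + g) <= q * (`|v| + 1) by apply: ler_pM => //; lra.
  nra.
have yr : `|y - x| < r by rewrite (lt_le_trans yx) // -qE; nra.
apply: (near_x _ _).2.
  by rewrite /ball_ /= distrC (lt_le_trans bx) // ge_min lexx.
have : 0 <= f y.
  apply: (near_x _ _).1 => //.
  by rewrite /ball_ /= distrC (lt_le_trans yr) // ge_min lexx.
have := H y (y + s *: (v + u)).
rewrite (lt_le_trans yr) ?ge_min ?lexx ?orbT //.
rewrite (lt_le_trans bx) ?ge_min ?lexx ?orbT // => /(_ isT isT).
rewrite [y + _]addrC addrK dotZ dotD lv ler_norml => /andP[h _] fy.
have lu : - (L * g) <= dot l u.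
  have := dot_le l u; rewrite ler_norml => /andP[+ _]; apply: le_trans.
  by rewrite lerN2 ler_wpM2l.
have : eta * `|s *: (v + u)| <= eta * (s * (`|v| + g)) by rewrite ler_wpM2l // ltW.
have : s * (- (L * g)) <= s * dot l u by rewrite ler_wpM2l.
have : 0 <= s * g by rewrite mulr_ge0 // ltW.
have : 0 <= s * (1 - g) * eta by rewrite !mulr_ge0 // ?subr_ge0 // ltW.
nra.
Qed.

(** Linearising f at the barycenter y and averaging over the vertices, where f >= 0, gives f y >= -
    q r. Moving y by 2 q r v gains 2 q r up to an error of at most q r, so the new point is in [K].
    Since q is as small as desired, hulls stay within o(r) of [K]. *)
Lemma local_hull x f eta : local_equation K x f -> 0 < eta ->
  exists2 rho : R, 0 < rho & forall n (p : 'I_n -> 'rV[R]_d) (t : 'rV[R]_n) r,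
    0 <= r <= rho -> (forall i, 0 <= t ord0 i) -> \sum_(i < n) t ord0 i = 1 ->
    (forall i, t ord0 i != 0 -> K (p i) /\ `|p i - x| < rho) ->
    (forall i j, t ord0 i != 0 -> t ord0 j != 0 -> `|p i - p j| <= r) ->
    exists2 z, K z & `|barycenter p t - z| <= eta * r.
Proof.
move=> [l [v [fx lv /nbhs_normP[rho1 /= rho10 near_x]]]] eta0.
have v0 : 0 <= `|v| by [].
pose q := Num.min eta 1 / (2 * (`|v| + 1)).
have m0 : 0 < Num.min eta 1 by rewrite lt_min eta0 ltr01.
have me : Num.min eta 1 <= eta by rewrite ge_min lexx.
have m1 : Num.min eta 1 <= 1 by rewrite ge_min lexx orbT.
have qE : q * (2 * (`|v| + 1)) = Num.min eta 1.
  by rewrite divfK // gt_eqF // mulr_gt0 // ltr_wpDl.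
have q0 : 0 < q by rewrite divr_gt0 // mulr_gt0 // ltr_wpDl.
have [rho2 rho20 H] := fx _ q0.
pose rho := Num.min rho1 rho2.
have rho0 : 0 < rho by rewrite lt_min rho10.
exists (rho / 3); first by rewrite divr_gt0.
move=> n p t r /andP[r0 rr] t0 t1 Kp pr.
set y := barycenter p t.
have yx : `|y - x| <= rho / 3.
  by apply: barycenter_dist_le => // i ti; rewrite ltW // (Kp _ ti).2.
have small z : `|z - x| < rho -> `|z - x| < rho1 /\ `|z - x| < rho2.
  by move=> h; split; rewrite (lt_le_trans h) // ge_min lexx ?orbT.
have yr : `|y - x| < rho by rewrite (le_lt_trans yx) //; lra.
have py i : t ord0 i != 0 -> `|p i - y| <= r.
  move=> ti; rewrite distrC; apply: barycenter_dist_le => // j tj; exact: pr.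
have fy : - (q * r) <= f y.
  have ly : dot l y = \sum_(i < n) t ord0 i * dot l (p i).
    rewrite /y /barycenter (big_morph (dot l) (dotD l) (_ : _ = 0)).
      by apply: eq_bigr => i _; rewrite dotZ.
    by rewrite -(scale0r 0) dotZ mul0r.
  (* The linear terms have t-average 0 because y is the barycenter. *)
  have -> : f y = \sum_(i < n) t ord0 i * (f y + dot l (p i) - dot l y).
    under eq_bigr do rewrite addrAC mulrDr.
    by rewrite big_split -mulr_suml /= t1 mul1r -ly subrK.
  rewrite -[- _]mul1r -t1 mulr_suml; apply: ler_sum => i _.
  have [->|ti] := eqVneq (t ord0 i) 0; first by rewrite !mul0r.
  have [Kpi pix] := Kp _ ti.
  have pir : `|p i - x| < rho by rewrite (lt_le_trans pix) //; lra.
  have fp : 0 <= f (p i).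
    by apply: (near_x _ _).1 => //; rewrite /ball_ /= distrC; exact: (small _ pir).1.
  have := H y (p i) (small _ yr).2 (small _ pir).2.
  rewrite dotB ler_norml => /andP[_ h].
  have : q * `|p i - y| <= q * r by rewrite ler_wpM2l ?py // ltW.
  by move=> h'; rewrite ler_wpM2l //; lra.
pose z := y + (2 * q * r) *: v.
have zy : `|z - y| <= eta * r /\ `|z - y| <= r.
  rewrite /z [y + _]addrC addrK normrZ ger0_norm; last by rewrite !mulr_ge0 // ltW.
  have : 0 <= q * r by rewrite mulr_ge0 // ltW.
  by split; nra.
exists z; last by rewrite distrC zy.1.
have zr : `|z - x| < rho.
  rewrite -(subrK y z) -addrA (le_lt_trans (ler_normD _ _)) //.
  have := zy.2; lra.
apply: (near_x _ _).2; first by rewrite /ball_ /= distrC; exact: (small _ zr).1.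
have := H y z (small _ yr).2 (small _ zr).2.
rewrite {2 3}/z [y + _]addrC addrK dotZ lv mulr1 normrZ.
rewrite ger0_norm; last by rewrite !mulr_ge0 // ltW.
rewrite ler_norml => /andP[h _].
have : 0 <= q * r by rewrite mulr_ge0 // ltW.
nra.
Qed.

End LocalEquation.

(** * Inward vector fields *)

(** Compactness as an induction principle: a finite subcover by balls with P is glued one ball at a
    time. It carries the local estimates over to all of [K]. *)
Lemma compact_ball_ind (R : realType) (d : nat) (K : set 'rV[R]_d)
    (P : set 'rV[R]_d -> Prop) : compact K -> P set0 ->
  (forall A B, P A -> P B -> P (A `|` B)) ->
  (forall A B, A `<=` B -> P B -> P A) ->
  (forall x, K x -> exists2 rho : R, 0 < rho & P [set y | `|y - x| < rho]) ->
  P K.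
Proof.
rewrite compact_cover => cK P0 PU PS Pball.
pose D : set ('rV[R]_d * R) := [set z | 0 < z.2 /\ P [set y | `|y - z.1| < z.2]].
pose B (z : 'rV[R]_d * R) := [set y | `|y - z.1| < z.2].
have [|x Kx|S SD KS] := cK _ D B.
- move=> z _; rewrite (_ : B z = ball z.1 z.2); first exact: ball_open.
  by apply/seteqP; split=> y; rewrite /B -ball_normE /ball_ /= distrC.
- have [rho rho0 Prho] := Pball x Kx.
  by exists (x, rho) => //; rewrite /B /= subrr normr0.
apply: (PS _ _ KS).
have : P (\bigcup_(z in [set` (finmap.enum_fset S)]) B z).
  have: {subset finmap.enum_fset S <= D} by [].
  elim: (finmap.enum_fset S) => [_|z s IH sD].
    by apply: (PS _ set0) => // y [].
  apply: (PS _ (B z `|` \bigcup_(z in [set` s]) B z)).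
    move=> y [w /=]; rewrite inE => /orP[/eqP->|ws] By; [by left|right].
    by exists w.
  apply: PU; last by apply: IH => w ws; apply: sD; rewrite inE ws orbT.
  by have /set_mem[] := sD z (mem_head _ _).
by apply: PS => y [w wS Bw]; exists w.
Qed.

Section Inward.
Variables (R : realType) (d : nat) (K : set 'rV[R]_d).
Implicit Types (A : set 'rV[R]_d) (v : 'rV[R]_d -> 'rV[R]_d).

(* The field points weakly into K everywhere and robustly on A.  Such fields
   can be added up, so local ones are glued without normalization. *)
Definition inward A v (g s0 M : R) :=
  [/\ continuous v, forall y, `|v y| <= M,
    0 < g /\ 0 < s0,
    forall x y s, K x -> `|x - y| <= s0 -> 0 <= s <= s0 -> K (x + s *: v y) &
    forall x y s u, K x -> A x -> `|x - y| <= s0 -> 0 <= s <= s0 -> `|u| <= g ->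
      K (x + s *: (v y + u))].

Definition has_inward A := exists v g s0 M, inward A v g s0 M.

Lemma has_inward0 : has_inward set0.
Proof.
exists (fun=> 0), 1, 1, 0; split=> //; first exact: cst_continuous.
- by move=> y; rewrite normr0.
- by move=> x y s Kx; rewrite scaler0 addr0.
Qed.

Lemma has_inwardS A B : A `<=` B -> has_inward B -> has_inward A.
Proof.
move=> AB [v [g [s0 [M [vc vM p0 weak strong]]]]].
exists v, g, s0, M; split=> // x y s u Kx Ax; apply: strong => //; exact: AB.
Qed.

(** A step along the sum is a step along each field in turn. The robust one goes first, as it must
    start in its own set; the weak one only has to start in [K]. Both fields are evaluated at the
    same y while the base point moves, hence the separate x and y in [inward]. *)
Lemma has_inwardU A B : has_inward A -> has_inward B -> has_inward (A `|` B).
Proof.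
move=> [v [g [s0 [M [vc vM [g0 s00] weak strong]]]]].
move=> [v' [g' [s0' [M' [vc' vM' [g0' s00'] weak' strong']]]]].
have M0 : 0 <= M by exact: le_trans (vM 0).
have M0' : 0 <= M' by exact: le_trans (vM' 0).
(* With distance and time at most m/c, the point after the first step is still within m of y. *)
pose c := 1 + M + M' + g + g'.
have c0 : 0 < c by rewrite /c; lra.
pose m := Num.min s0 s0'.
have m0 : 0 < m by rewrite lt_min s00.
have mcE : m / c * c = m by rewrite divfK // gt_eqF.
have ms : m <= s0 by rewrite ge_min lexx.
have ms' : m <= s0' by rewrite ge_min lexx orbT.
have mc0 : 0 < m / c by rewrite divr_gt0.
have mm : m / c <= m by rewrite ler_pdivrMr // /c; nra.
have step x y s w : `|x - y| <= m / c -> 0 <= s <= m / c ->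
    `|w| <= M + M' + g + g' -> `|x + s *: w - y| <= m.
  move=> xy /andP[s0_ s1] wM; rewrite addrAC (le_trans (ler_normD _ _)) //.
  rewrite normrZ (ger0_norm s0_) -mcE /c.
  have : s * `|w| <= m / c * (M + M' + g + g') by exact: ler_pM.
  rewrite /c in xy *; nra.
exists (fun y => v y + v' y), (Num.min g g'), (m / c), (M + M'); split.
- by move=> y; apply: continuousD; [exact: vc|exact: vc'].
- by move=> y; rewrite (le_trans (ler_normD _ _)) // lerD.
- by rewrite lt_min g0 g0'.
- move=> x y s Kx xy sm; rewrite scalerDr addrA.
  have /andP[sp s1] := sm; have vy := vM y.
  apply: weak'; [apply: weak => //| |by rewrite sp; lra].
  + by lra.
  + by rewrite sp; lra.
  + by apply: le_trans ms'; apply: step => //; lra.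
- move=> x y s u Kx ABx xy sm; rewrite le_min => /andP[ug ug'].
  have /andP[sp s1] := sm; have vy := vM y; have vy' := vM' y.
  case: ABx => [Ax|Bx].
  + rewrite addrAC scalerDr addrA.
    apply: weak'; [apply: strong => //| |by rewrite sp; lra].
    * by lra.
    * by rewrite sp; lra.
    * apply: le_trans ms'; apply: step => //.
      by rewrite (le_trans (ler_normD _ _)) //; lra.
  + rewrite -addrA [v y + _]addrC scalerDr addrA.
    apply: weak; [apply: strong' => //| |by rewrite sp; lra].
    * by lra.
    * by rewrite sp; lra.
    * apply: le_trans ms; apply: step => //.
      by rewrite (le_trans (ler_normD _ _)) //; lra.
Qed.

(** Cut the constant field w off by a tent function chi. Where chi is 0 nothing moves; near the
    smaller ball chi >= rho/8, so a perturbation of size g rho/8 becomes one of size at most g after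
    division by chi. *)
Lemma has_inward_cone x (w : 'rV[R]_d) (g rho : R) : 0 < g -> 0 < rho ->
  (forall y u s, K y -> `|y - x| < rho -> 0 <= s <= rho -> `|u| <= g ->
    K (y + s *: (w + u))) ->
  has_inward [set y | `|y - x| < rho / 4].
Proof.
move=> g0 rho0 cone.
pose chi y := Num.max 0 (rho / 2 - `|y - x|).
have chi0 y : 0 <= chi y by rewrite le_max lexx.
have chi1 y : chi y <= rho / 2.
  by rewrite ge_max; apply/andP; split; [lra|rewrite gerBl].
have chi_cont (F : set_system 'rV[R]_d) y : Filter F -> z @[z --> F] --> y ->
    chi z *: w @[z --> F] --> chi y *: w.
  move=> FF Fy; apply: cvgZ; last exact: cvg_cst.
  apply: cvg_maxr; first exact: cvg_cst.
  apply: cvgB; first exact: cvg_cst.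
  by apply: cvg_norm; apply: cvgB => //; exact: cvg_cst.
pose s0 := Num.min (rho / 8) 1.
have s00 : 0 < s0 by rewrite lt_min ltr01 andbT; lra.
have s01 : s0 <= 1 by rewrite ge_min lexx orbT.
have s0r : s0 <= rho / 8 by rewrite ge_min lexx.
have chis y s : 0 <= s <= s0 -> 0 <= s * chi y <= rho.
  move=> /andP[sp s1]; rewrite mulr_ge0 //=.
  have : s * chi y <= 1 * (rho / 2) by apply: ler_pM => //; lra.
  lra.
have near y z : `|z - y| <= s0 -> `|z - x| <= s0 + `|y - x|.
  move=> zy; rewrite -(subrK y z) -addrA (le_trans (ler_normD _ _)) //.
  by rewrite lerD2r.
exists (fun y => chi y *: w), (g * (rho / 8)), s0, (rho / 2 * `|w|); split.
- by move=> y; exact (@chi_cont (nbhs y) y (nbhs_filter y) cvg_id).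
- by move=> y; rewrite normrZ ger0_norm // ler_wpM2r.
- by split=> //; rewrite mulr_gt0 // divr_gt0.
- move=> z y s Kz zy sm; rewrite scalerA -[w]addr0.
  have [yx|yx] := leP (rho / 2) `|y - x|.
    by rewrite /chi max_l ?mulr0 ?scale0r ?addr0 // subr_le0.
  apply: cone => //; [|exact: chis|by rewrite normr0 ltW].
  by rewrite (le_lt_trans (near _ _ zy)) //; lra.
- move=> z y s u Kz /= zx zy sm ug.
  have yx : `|y - x| <= s0 + rho / 4.
    rewrite -(subrK z y) -addrA (le_trans (ler_normD _ _)) //.
    by apply: lerD; [rewrite distrC|exact: ltW].
  have chiy : rho / 8 <= chi y by rewrite le_max; apply/orP; right; lra.
  have chip : 0 < chi y by apply: lt_le_trans chiy; lra.
  have -> : s *: (chi y *: w + u) = (s * chi y) *: (w + (chi y)^-1 *: u).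
    rewrite -scalerA; congr (s *: _).
    by rewrite scalerDr scalerA divff ?scale1r ?gt_eqF.
  apply: cone => //; [lra|exact: chis|].
  rewrite normrZ ger0_norm ?invr_ge0 // ler_pdivrMl // mulrC.
  by rewrite (le_trans ug) // ler_wpM2l // ltW.
Qed.

Lemma has_inward_manifold : (0 < d)%N -> compact K ->
  smooth_manifold_with_boundary K -> has_inward K.
Proof.
move=> d0 cK mK; apply: (compact_ball_ind cK).
- exact: has_inward0.
- exact: has_inwardU.
- exact: has_inwardS.
move=> x Kx; have [f fx] := manifold_local_equation d0 mK Kx.
have [w [g [rho [g0 rho0 cone]]]] := local_cone fx.
by exists (rho / 4); [rewrite divr_gt0|exact: has_inward_cone cone].
Qed.

Lemma hull_near_manifold eta : (0 < d)%N -> compact K ->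
  smooth_manifold_with_boundary K -> 0 < eta ->
  exists2 rho : R, 0 < rho & forall n (p : 'I_n -> 'rV[R]_d) (t : 'rV[R]_n) r,
    0 <= r <= rho -> (forall i, 0 <= t ord0 i) -> \sum_(i < n) t ord0 i = 1 ->
    (forall i, t ord0 i != 0 -> K (p i)) ->
    (forall i j, t ord0 i != 0 -> t ord0 j != 0 -> `|p i - p j| <= r) ->
    exists2 z, K z & `|barycenter p t - z| <= eta * r.
Proof.
move=> d0 cK mK eta0.
(* Asking for just one vertex in A makes the property stable under unions; short edges then bring
   the other vertices into the local ball. *)
pose P A := exists2 rho : R, 0 < rho &
  forall n (p : 'I_n -> 'rV[R]_d) (t : 'rV[R]_n) r,
    0 <= r <= rho -> (forall i, 0 <= t ord0 i) -> \sum_(i < n) t ord0 i = 1 ->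
    (forall i, t ord0 i != 0 -> K (p i)) ->
    (forall i j, t ord0 i != 0 -> t ord0 j != 0 -> `|p i - p j| <= r) ->
    (exists2 i, t ord0 i != 0 & A (p i)) ->
    exists2 z, K z & `|barycenter p t - z| <= eta * r.
suff [rho rho0 H] : P K.
  exists rho => // n p t r rr t0 t1 Kp pr; apply: H => //.
  have [i ti] : exists i, t ord0 i != 0.
    apply/not_existsP => tz; move/eqP: t1; rewrite big1 ?(eq_sym 0) ?oner_eq0 //.
    by move=> i _; have /negP := tz i; rewrite negbK => /eqP.
  by exists i => //; exact: Kp.
apply: (compact_ball_ind cK).
- by exists 1 => // n p t r _ _ _ _ _ [].
- move=> A B [a a0 HA] [b b0 HB]; exists (Num.min a b); first by rewrite lt_min a0.
  move=> n p t r; rewrite le_min => /and3P[r0 ra rb] t0 t1 Kp pr [i ti [Ai|Bi]].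
    by apply: HA => //; [rewrite r0|exists i].
  by apply: HB => //; [rewrite r0|exists i].
- move=> A B AB [b b0 HB]; exists b => // n p t r rb t0 t1 Kp pr [i ti Ai].
  by apply: HB => //; exists i => //; exact: AB.
move=> x Kx; have [f fx] := manifold_local_equation d0 mK Kx.
have [rho rho0 H] := local_hull fx eta0.
exists (rho / 2); first by rewrite divr_gt0.
exists (rho / 2); first by rewrite divr_gt0.
move=> n p t r /andP[r0 rr] t0 t1 Kp pr [i ti /= pix]; apply: H => //.
  by rewrite r0; lra.
move=> j tj; split; first exact: Kp.
rewrite -(subrK (p i) (p j)) -addrA (le_lt_trans (ler_normD _ _)) //.
have := pr _ _ tj ti; lra.
Qed.

End Inward.

(** All the geometry that the random part uses. The last clause gives cubes of size comparable to r
    inside [K] near every point of [K]; hitting them makes the sample dense. *)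
Lemma rips_manifold_equivalence (R : realType) (d : nat) (K : set 'rV[R]_d) :
  (0 < d)%N -> compact K -> smooth_manifold_with_boundary K ->
  exists c2 delta kappa : R, [/\ 0 < c2, 0 < delta, 0 < kappa,
    forall n (p : 'I_n -> 'rV[R]_d) r, 0 < r <= c2 -> (forall i, K (p i)) ->
      (forall x, K x -> exists i, `|x - p i| < delta * r) ->
      homotopy_equivalent (rips_realization p r) K &
    forall r x, 0 < r <= c2 -> K x -> exists2 c, K c &
      forall z, `|z - c| <= kappa * r -> K z /\ `|z - x| < delta * r].
Proof.
move=> d0 cK mK.
have [v [g [s0 [M [vc vM [g0 s00] _ strong]]]]] := has_inward_manifold d0 cK mK.
have M0 : 0 <= M by exact: le_trans (vM 0).
have D0 : 0 < d%:R :> R by rewrite ltr0n.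
(* With push time s = theta r and radius e = delta r = g s, this gives 8 d (e + s M) = r. *)
pose theta : R := (8 * d%:R * (g + M))^-1.
have den0 : 0 < 8 * d%:R * (g + M) by rewrite !mulr_gt0 // ltr_wpDr.
have theta0 : 0 < theta by rewrite invr_gt0.
have thetaE : 8 * d%:R * (g + M) * theta = 1 by rewrite mulfV // gt_eqF.
pose delta := g * theta.
have delta0 : 0 < delta by rewrite mulr_gt0.
(* A push for time tau r moves a point by at most tau M r, and the cube around the result has radius
   g tau r: together half of delta r. *)
pose tau := delta / (2 * (g + M)).
have gM0 : 0 < g + M by rewrite ltr_wpDr.
have tau0 : 0 < tau by rewrite divr_gt0 // mulr_gt0.
have tauE : tau * (2 * (g + M)) = delta by rewrite divfK // gt_eqF // mulr_gt0.
have [rho rho0 hull] := hull_near_manifold d0 cK mK delta0.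
(* Within the range rho of the hull estimate, and with theta r, delta r and tau r at most s0. *)
pose c2 := Num.min rho (Num.min (s0 / theta) (Num.min (s0 / delta) (s0 / tau))).
exists c2, delta, (g * tau); split=> //.
- by rewrite !lt_min rho0 /=; apply/and3P; split; exact: divr_gt0.
- by rewrite mulr_gt0.
- move=> n p r /andP[r0]; rewrite !le_min => /and4P[r1 r2 r3 _] pK pD.
  have r2' : theta * r <= s0 by rewrite mulrC -ler_pdivlMr.
  have r3' : delta * r <= s0 by rewrite mulrC -ler_pdivlMr.
  apply: (@rips_homotopy_equivalent _ _ _ _ _ v r (delta * r) (theta * r) g M) => //.
  + by apply: mulr_ge0; apply: ltW.
  + by apply: mulr_ge0; apply: ltW.
  + move=> x y s /andP[sp s1] Kx yx.
    have [sz|sz] := eqVneq s 0.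
      by move: yx; rewrite sz mulr0 scale0r addr0 normr_le0 subr_eq0 => /eqP->.
    have spos : 0 < s by rewrite lt_neqAle eq_sym sz.
    (* An offset y - x of size at most g s is a perturbation of the field of size at most g, started
       at x in [K]. *)
    have -> : y + s *: v y = x + s *: (v y + s^-1 *: (y - x)).
      by rewrite scalerDr scalerA divff // scale1r [s *: v y + _]addrC addrA
        [x + _]addrC subrK.
    apply: strong => //.
    * rewrite distrC (le_trans yx) // (le_trans _ r3') // /delta -mulrA.
      by rewrite ler_wpM2l // ltW.
    * by rewrite sp (le_trans s1).
    * by rewrite normrZ ger0_norm ?invr_ge0 // ler_pdivrMl // mulrC.
  + move=> t [t0 [t1 /andP[_ /forallP tr]]]; rewrite mulrA; apply: hull => //.
    * by rewrite r1 ltW.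
    * move=> i j ti tj; apply: le_trans (norm_le_edist _ _) _.
      have := implyP (tr i); rewrite inE ti => /(_ erefl)/forallP/(_ j).
      by rewrite inE tj.
  + by rewrite /delta mulrA.
  + have -> : 8 * d%:R * (delta * r + theta * r * M) =
      8 * d%:R * (g + M) * theta * r by rewrite /delta; ring.
    by rewrite thetaE mul1r.
- move=> r x /andP[r0]; rewrite !le_min => /and4P[_ _ _ r4] Kx.
  have r4' : tau * r <= s0 by rewrite mulrC -ler_pdivlMr.
  have tr0 : 0 < tau * r by rewrite mulr_gt0.
  have xx : `|x - x| <= s0 by rewrite subrr normr0 ltW.
  have ss : 0 <= tau * r <= s0 by rewrite r4' ltW.
  have in_K u : `|u| <= g -> K (x + (tau * r) *: (v x + u)) by exact: strong.
  exists (x + (tau * r) *: v x).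
    by rewrite -[v x]addr0; apply: in_K; rewrite normr0 ltW.
  move=> z; set c := x + _ => zc; split.
    have -> : z = x + (tau * r) *: (v x + (tau * r)^-1 *: (z - c)).
      rewrite scalerDr scalerA divff ?gt_eqF // scale1r addrA -/c.
      by rewrite [c + _]addrC subrK.
    apply: in_K; rewrite normrZ ger0_norm ?invr_ge0 ?(ltW tr0) //.
    by rewrite ler_pdivrMl // mulrC mulrA.
  rewrite -(subrK c z) -addrA (le_lt_trans (ler_normD _ _)) //.
  have -> : c - x = (tau * r) *: v x by rewrite /c addrC addKr.
  rewrite normrZ (gtr0_norm tr0).
  have : tau * r * `|v x| <= tau * r * M by rewrite ler_wpM2l // ltW.
  have := mulr_gt0 tr0 gM0; rewrite -tauE; nra.
Qed.

(** * Covering by random samples *)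

Section Boxes.
Variables (R : realType) (d : nat).

Lemma closed_borelRd (A : set 'rV[R]_d) : closed A ->
  measurable (A : set (borelRd R d)).
Proof.
move=> cA; rewrite -[A]setCK; apply: measurableC.
by apply: sub_sigma_algebra; exact: closed_openC.
Qed.

Definition box (a b : 'rV[R]_d) : set 'rV[R]_d :=
  [set x | forall i, a ord0 i <= x ord0 i <= b ord0 i].

Lemma closed_box a b : closed (box a b).
Proof.
rewrite (_ : box a b = \bigcap_(i in [set: 'I_d])
    ((fun x : 'rV[R]_d => x ord0 i) @^-1` [set` `[a ord0 i, b ord0 i]])); last first.
  apply/seteqP; split=> x /= h i; first by move=> _; rewrite /= in_itv /= h.
  by have := h i I; rewrite /= in_itv.
apply: closed_bigI => i _; apply: closed_comp; last exact: interval_closed.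
by move=> x _; exact: coord_continuous.
Qed.

Variables (N : nat) (c h : R).

(** Closed cells share faces, which is harmless: they only have to cover, and [is_lebesgue_measure]
    speaks of closed boxes. *)
Definition grid_lo (z : {ffun 'I_d -> 'I_N}) : 'rV[R]_d :=
  \row_i (c + (z i)%:R * h).
Definition grid_hi (z : {ffun 'I_d -> 'I_N}) : 'rV[R]_d :=
  \row_i (c + (z i).+1%:R * h).
Definition grid_cell z := box (grid_lo z) (grid_hi z).

Lemma grid_cell_lebesgue (lam : {measure set (borelRd R d) -> \bar R}) z :
  0 <= h -> is_lebesgue_measure lam -> lam (grid_cell z) = (h ^+ d)%:E.
Proof.
move=> h0 hlam; rewrite [LHS]hlam; last first.
  by move=> i; rewrite !mxE lerD2l ler_wpM2r // ler_nat.
congr EFin; rewrite -[X in _ ^+ X](card_ord d) -prodr_const.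
apply: eq_bigr => i _; rewrite !mxE -natr1; ring.
Qed.

Lemma grid_cell_diam z (x y : 'rV[R]_d) : 0 <= h ->
  grid_cell z x -> grid_cell z y -> `|x - y| <= h.
Proof.
move=> h0 zx zy; apply/rV_normP => // i.
have := zx i; have := zy i; rewrite !mxE -natr1 mulrDl mul1r.
move=> /andP[? ?] /andP[? ?]; rewrite ler_norml; apply/andP; split; lra.
Qed.

Lemma grid_cellP (x : 'rV[R]_d) : 0 < h ->
  (forall i, c <= x ord0 i < c + N%:R * h) -> exists z, grid_cell z x.
Proof.
move=> h0 xN.
have lt i : (Num.trunc ((x ord0 i - c) / h) < N)%N.
  have /andP[x1 x2] := xN i.
  rewrite truncn_lt_nat; last by rewrite divr_ge0 ?subr_ge0 ?(ltW h0).
  by rewrite ltr_pdivrMr // ltrBlDl.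
exists [ffun i => Ordinal (lt i)] => i; rewrite !mxE ffunE /=.
have /andP[x1 x2] := xN i.
have q0 : 0 <= (x ord0 i - c) / h by rewrite divr_ge0 ?subr_ge0 // ltW.
have /andP[t1 t2] := truncn_itv q0.
apply/andP; split.
  by rewrite -lerBrDl -ler_pdivlMr.
by rewrite -lerBlDl -ler_pdivrMr // ltW.
Qed.

End Boxes.

Lemma measure_bigcup_fin_le (R : realType) dO (O : measurableType dO)
    (P : {measure set O -> \bar R}) (I : Type) (s : seq I) (F : I -> set O) :
  (forall i, measurable (F i)) ->
  measurable (\big[setU/set0]_(i <- s) F i) /\
  (P (\big[setU/set0]_(i <- s) F i) <= \sum_(i <- s) P (F i))%E.
Proof.
move=> mF; elim: s => [|i s [mS IH]]; first by rewrite !big_nil measure0.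
rewrite !big_cons; split; first exact: measurableU.
by rewrite (le_trans (measureU2 _ _ _)) // leeD2l.
Qed.

(** * Independent samples and the union bound *)

Section Sampling.
Variables (R : realType) (d : nat) (dO : measure_display).
Variables (O : measurableType dO) (P : probability O R).
Variables (X : nat -> O -> 'rV[R]_d) (nu : probability (borelRd R d) R).
Hypothesis X_iid : iid_with_law P X nu.

Lemma all_in_prob n (A : set (borelRd R d)) : measurable A ->
  measurable (\bigcap_(i in `I_n) (X i @^-1` A)) /\
  (P (\bigcap_(i in `I_n) (X i @^-1` A)) = (fine (nu A) ^+ n)%:E)%E.
Proof.
move=> mA; split.
  apply: bigcap_measurableType => i _; rewrite -[X in measurable X]setTI.
  exact: (X_iid.1 i).
rewrite (X_iid.2 n (fun=> A) (fun=> mA)).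
have -> : nu A = (fine (nu A))%:E by rewrite fineK // fin_num_measure.
by rewrite prodEFin prodr_const card_ord.
Qed.

(** All n points miss a cell of mass at least q with probability at most (1 - q)^n <= exp(-n q); sum
    over the cells. Requiring the points to lie in [K] costs no probability. *)
Lemma covering_event (K : set (borelRd R d)) (I : finType)
    (Q : I -> set (borelRd R d)) (q : R) (n : nat) :
  measurable K -> nu K = 1%E -> (forall z, measurable (Q z)) ->
  (forall z, Q z `<=` K -> (q%:E <= nu (Q z))%E) ->
  exists A : set O, [/\ measurable A,
    forall w, A w -> forall i : 'I_n, K (X i w),
    forall w z, A w -> Q z `<=` K -> exists i : 'I_n, Q z (X i w) &
    ((1 - #|I|%:R * expR (- (n%:R * q)))%:E <= P A)%E].
Proof.
move=> mK nuK mQ nuQ.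
pose E0 := \bigcap_(i in `I_n) (X i @^-1` K).
(* A cell not contained in [K] gets an empty failure event, so the union can run over all
   indices. *)
pose F z := if pselect (Q z `<=` K) then \bigcap_(i in `I_n) (X i @^-1` (~` Q z))
  else set0.
have [mE0 PE0] := all_in_prob n mK.
have mF z : measurable (F z).
  rewrite /F; case: pselect => ?; last exact: measurable0.
  by have [] := @all_in_prob n (~` Q z) (measurableC (mQ z)).
have PF z : (P (F z) <= (expR (- (n%:R * q)))%:E)%E.
  rewrite /F; case: pselect => QK /=; last by rewrite measure0 lee_fin expR_ge0.
  have [_ ->] := @all_in_prob n (~` Q z) (measurableC (mQ z)).
  rewrite lee_fin mulrC -mulNr expRM_natr.
  have fQ := fin_num_measure nu _ (mQ z).
  rewrite probability_setC // fineB //.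
  have q1 : q <= fine (nu (Q z)) by rewrite -lee_fin fineK // nuQ.
  have q2 : fine (nu (Q z)) <= 1 by rewrite -lee_fin fineK // probability_le1.
  apply: lerXn2r; rewrite ?nnegrE ?expR_ge0 ?subr_ge0 //.
  by rewrite (le_trans _ (expR_ge1Dx _)) // lerD2l lerN2.
have [mU PU] := @measure_bigcup_fin_le _ _ _ P _ (index_enum I) F mF.
set U := \big[setU/set0]_(i <- _) F i in mU PU.
exists (E0 `&` ~` U); split.
- by apply: measurableI => //; exact: measurableC.
- by move=> w [Ew _] i; apply: Ew; exact: ltn_ord.
- move=> w z [_ Uw] QK; apply: contrapT => nQ; apply: Uw.
  rewrite /U (bigD1 z) //=; left; rewrite /F; case: pselect => // ?.
  by move=> i ltin /= Qi; apply: nQ; exists (Ordinal ltin).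
have -> : E0 `&` ~` U = ~` (~` E0 `|` U) by rewrite setCU setCK.
have mE0C : measurable (~` E0) by exact: measurableC.
rewrite probability_setC; last exact: measurableU.
have PE0C : P (~` E0) = 0%E.
  by rewrite probability_setC // PE0 nuK /= expr1n subee.
rewrite EFinB leeB //.
have PU2 : (P (~` E0 `|` U) <= P (~` E0) + P U)%E by exact: measureU2.
rewrite (le_trans PU2) // PE0C add0e (le_trans PU) //.
rewrite (@le_trans _ _ (\sum_(i : I) (expR (- (n%:R * q)))%:E)%E) //.
  by apply: lee_sum => z _; exact: PF.
by rewrite sumEFin sumr_const -[X in (X%:E <= _)%E]mulr_natl.
Qed.

End Sampling.

(** * Mass of cells under a density bounded below *)

Section Density.
Variables (R : realType) (d : nat) (K : set 'rV[R]_d).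
Variables (lam : {measure set (borelRd R d) -> \bar R}).
Variables (nu : probability (borelRd R d) R) (f : borelRd R d -> R).
Hypotheses (mf : measurable_fun setT f) (f0 : forall x, 0 <= f x).
Hypothesis nuE : forall A : set (borelRd R d), measurable A ->
  nu A = (\int[lam]_(x in A) (f x)%:E)%E.
Hypothesis fK : closure [set x : 'rV[R]_d | f x != 0] = K.

Lemma density_support : nu K = 1%E.
Proof.
have mK : measurable (K : set (borelRd R d)).
  by apply: closed_borelRd; rewrite -fK; exact: closed_closure.
rewrite -[K]setCK probability_setC; last exact: measurableC.
rewrite nuE; last exact: measurableC.
rewrite integral0_eq ?sube0 // => x /= Kx; congr EFin.
apply: contrapT => /eqP fx; apply: Kx; rewrite -fK; exact: subset_closure.
Qed.

Lemma density_lower_bound (A : set (borelRd R d)) (V : R) : measurable A ->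
  A `<=` K -> lam A = V%:E -> ((inf [set f x | x in K] * V)%:E <= nu A)%E.
Proof.
move=> mA AK lamA; rewrite nuE // EFinM -lamA -integral_cst //.
have inf_le x : K x -> inf [set f x | x in K] <= f x.
  move=> Kx; apply: ge_inf; last by exists x.
  by exists 0 => _ [y _ <-].
(* The bound on the infimum is for a nonempty [K]; if [K] is empty, so is A. *)
have [[x0 Kx0]|K0] := pselect (K !=set0); last first.
  rewrite [A](_ : _ = set0) ?integral_set0 // -subset0 => x /AK Kx.
  by apply: K0; exists x.
have inf0 : 0 <= inf [set f x | x in K].
  by apply: lb_le_inf; [exists (f x0), x0|move=> _ [y _ <-]].
apply: ge0_le_integral => //.
- by apply/measurable_EFinP; exact: measurable_funTS.
- by move=> x /AK Kx; rewrite lee_fin inf_le.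
Qed.

End Density.

(** With h = kappa r there are at most C^d / h^d = O(n / ln n) cells, each missed with probability
    at most n^-2, so the product is O(1/n). *)
Lemma grid_failure_bound (R : realType) (d : nat) (m kappa C : R) :
  (0 < d)%N -> 0 < m -> 0 < kappa -> 0 <= C ->
  exists c1 Q : R, 0 < c1 /\ forall n r, (2 <= n)%N ->
    c1 * (ln n%:R / n%:R) `^ (d%:R^-1) <= r ->
    0 < r /\ forall N : nat, N%:R * (kappa * r) <= C ->
      (N ^ d)%:R * expR (- (n%:R * (m * (kappa * r) ^+ d))) <= Q * harmonic n.
Proof.
move=> d0 m0 k0 C0.
(* The term 2/m yields the bound n^-2; the summand 1 ensures b >= 1 and so b <= b^d. *)
pose b : R := 2 / m + 1.
have b1 : 1 <= b by rewrite lerDr divr_ge0 // ltW.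
have b0 : 0 < b by exact: lt_le_trans b1.
have ln2 : 0 < ln (2 : R) by rewrite ln_gt0 // ltr1n.
(* [ln 2] bounds ln n from below, and the factor 2 absorbs that [harmonic n] is 1/(n+1). *)
pose Q := 2 * (C ^+ d / (b * ln 2)).
exists (b / kappa), Q; split; first exact: divr_gt0.
move=> n r n2 hr.
have n0 : 0 < n%:R :> R by rewrite ltr0n (leq_trans _ n2).
have lnn : ln 2 <= ln n%:R :> R by rewrite ler_ln ?posrE ?ler_nat.
have L0 : 0 < ln n%:R / n%:R :> R by rewrite divr_gt0 // (lt_le_trans ln2).
set L := ln n%:R / n%:R in hr L0.
have Ld : (L `^ d%:R^-1) ^+ d = L.
  rewrite -powR_mulrn ?powR_ge0 // -powRrM mulVf ?pnatr_eq0 ?gtn_eqF //.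
  by rewrite powRr1 // ltW.
have L'0 : 0 < L `^ d%:R^-1 by rewrite powR_gt0.
have r0 : 0 < r by apply: lt_le_trans hr; rewrite mulr_gt0 ?divr_gt0.
split=> // N NC.
set h := kappa * r in NC *.
have h0 : 0 < h by rewrite mulr_gt0.
have hb : b * L `^ d%:R^-1 <= h.
  have -> : b * L `^ d%:R^-1 = kappa * (b / kappa * L `^ d%:R^-1).
    by field; rewrite gt_eqF.
  by rewrite ler_wpM2l // ltW.
have hd : b * L <= h ^+ d.
  rewrite -[X in b * X]Ld; apply: (@le_trans _ _ ((b * L `^ d%:R^-1) ^+ d)).
    rewrite exprMn ler_wpM2r ?exprn_ge0 ?powR_ge0 //.
    by rewrite -[leLHS]expr1 ler_weXn2l.
  by rewrite lerXn2r // nnegrE ltW // mulr_gt0.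
have bL0 : 0 < b * L by rewrite mulr_gt0.
have Nd : (N ^ d)%:R <= C ^+ d / (b * L).
  rewrite ler_pdivlMr // natrX.
  apply: (@le_trans _ _ (N%:R ^+ d * h ^+ d)).
    by rewrite ler_wpM2l // exprn_ge0.
  by rewrite -exprMn lerXn2r // nnegrE // mulr_ge0 // ltW.
have ex : expR (- (n%:R * (m * h ^+ d))) <= n%:R^-1 * n%:R^-1.
  have -> : n%:R^-1 * n%:R^-1 = expR (- (2 * ln n%:R)) :> R.
    by rewrite mulr_natl mulr2n opprD expRD expRN lnK // posrE.
  rewrite ler_expR lerN2.
  have -> : ln n%:R = n%:R * L :> R by rewrite /L mulrC divfK // gt_eqF.
  rewrite mulrCA (ler_wpM2l (ltW n0)) //.
  apply: (@le_trans _ _ (m * (b * L))); last by rewrite ler_wpM2l // ltW.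
  rewrite mulrA (ler_wpM2r (ltW L0)) // /b mulrDr mulrCA mulfV ?gt_eqF //.
  by rewrite !mulr1 lerDl ltW.
apply: (@le_trans _ _ (C ^+ d / (b * L) * (n%:R^-1 * n%:R^-1))).
  by apply: ler_pM => //; exact: expR_ge0.
have -> : C ^+ d / (b * L) * (n%:R^-1 * n%:R^-1) =
    C ^+ d / (b * ln n%:R) * n%:R^-1.
  rewrite /L; field; rewrite !gt_eqF //.
  exact: lt_le_trans lnn.
have -> : Q * harmonic n = C ^+ d / (b * ln 2) * (2 * harmonic n).
  by rewrite /Q; ring.
have lnn0 : 0 < ln n%:R :> R by exact: lt_le_trans lnn.
have bln : (b * ln n%:R)^-1 <= (b * ln 2)^-1.
  by rewrite lef_pV2 ?posrE ?mulr_gt0 // ler_wpM2l // ltW.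
apply: ler_pM.
- by rewrite divr_ge0 ?exprn_ge0 // ltW // mulr_gt0.
- by rewrite invr_ge0 ltW.
- by rewrite ler_wpM2l // exprn_ge0.
- rewrite /harmonic /= ler_pdivlMr // ler_pdivrMl // -natr1.
  have : 1 <= n%:R :> R by rewrite ler1n ltnW.
  lra.
Qed.

(** * Combining the geometric and the probabilistic estimates *)

Unset Implicit Arguments.

Theorem theorem1p2 (R : realType) (d : nat) (hd : (0 < d)%N)
  (lam : {measure set (borelRd R d) -> \bar R})
  (hlam : is_lebesgue_measure lam)
  (K : set 'rV[R]_d) (hKc : compact K)
  (hKm : smooth_manifold_with_boundary K) :
  exists c2 : R, 0 < c2 /\
  forall (nu : probability (borelRd R d) R) (f : borelRd R d -> R),
    measurable_fun setT f ->
    (forall x, 0 <= f x) ->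
    (forall A : set (borelRd R d), measurable A ->
       nu A = (\int[lam]_(x in A) (f x)%:E)%E) ->
    closure [set x : 'rV[R]_d | f x != 0] = K ->
    0 < inf [set f x | x in K] ->
  exists c1 : R, 0 < c1 /\
  forall r : nat -> R,
    (\forall n \near \oo,
       c1 * (ln n%:R / n%:R) `^ (d%:R^-1) <= r n <= c2) ->
    forall (dO : measure_display) (O : measurableType dO)
           (P : probability O R) (X : nat -> O -> 'rV[R]_d),
    iid_with_law P X nu ->
    aas P (fun n => [set w | homotopy_equivalent
                         (rips_realization (fun i : 'I_n => X i w) (r n)) K]).
Proof.
have [c2 [delta [kappa [c20 delta0 kappa0 equiv fat]]]] :=
  rips_manifold_equivalence hd hKc hKm.
exists c2; split=> // nu f mf f0 nuE fK m0.
set m := inf _ in m0.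
have [B B0 KB] : exists2 B : R, 0 < B & forall x, K x -> `|x| <= B.
  exact: pinfty_ex_gt0 (compact_bounded hKc).
(* A uniform bound on the side N h of the grid: it covers a cube of side 2 B, with at most one extra
   cell of side h <= kappa c2. *)
have C0 : 0 <= 2 * B + kappa * c2 by rewrite addr_ge0 // mulr_ge0 // ltW.
have [c1 [Q [c10 tail]]] := grid_failure_bound hd m0 kappa0 C0.
exists c1; split=> // r r_range dO O P X X_iid.
pose E n := [set w | homotopy_equivalent
                         (rips_realization (fun i : 'I_n => X i w) (r n)) K].
have mK : measurable (K : set (borelRd R d)).
  by apply: closed_borelRd; rewrite -fK; exact: closed_closure.
have event n : exists A : set O, measurable A /\ A `<=` E n /\
    ((2 <= n)%N -> c1 * (ln n%:R / n%:R) `^ (d%:R^-1) <= r n <= c2 ->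
      ((1 - Q * harmonic n)%:E <= P A)%E).
  (* For the finitely many n outside the range the empty event serves. *)
  have [[n2 /andP[rl ru]]|bad] :=
    pselect ((2 <= n)%N /\ c1 * (ln n%:R / n%:R) `^ (d%:R^-1) <= r n <= c2);
    last first.
    exists set0; split; first exact: measurable0.
    by split=> // n2 rn; case: bad.
  have [r0 bound] := tail n (r n) n2 rl.
  pose h := kappa * r n.
  have h0 : 0 < h by rewrite mulr_gt0.
  (* The successor makes the grid reach strictly beyond B, as half-open coordinates in [grid_cellP]
     require. *)
  pose N := (Num.trunc (2 * B / h)).+1.
  have q0 : 0 <= 2 * B / h by rewrite divr_ge0 ?mulr_ge0 // ltW.
  have NC : N%:R * h <= 2 * B + kappa * c2.
    rewrite /N -natr1 mulrDl mul1r lerD //; last by rewrite ler_wpM2l // ltW.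
    by rewrite -ler_pdivlMr // truncn_le.
  have NB : 2 * B < N%:R * h by rewrite -ltr_pdivrMr // truncnS_gt.
  have [A [mA AK Acell PA]] := @covering_event _ _ _ _ _ _ _ X_iid K
    {ffun 'I_d -> 'I_N} (@grid_cell _ _ N (- B) h) (m * h ^+ d) n mK
    (density_support nuE fK) (fun z => closed_borelRd (@closed_box _ _ _ _))
    (fun z zK => density_lower_bound mf f0 nuE
      (closed_borelRd (@closed_box _ _ _ _)) zK
      (@grid_cell_lebesgue _ _ N (- B) h lam z (ltW h0) hlam)).
  exists A; split=> //; split; last first.
    move=> _ _; apply: le_trans PA; rewrite lee_fin lerD2l lerN2.
    by rewrite card_ffun !card_ord bound.
  move=> w Aw; apply: equiv; [by rewrite r0|by move=> i; exact: AK|].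
  move=> x Kx; have [|c Kc cball] := fat (r n) x _ Kx; first by rewrite r0.
  (* The cell through c has sup-diameter at most h = kappa r, so it lies in [K] and within delta r
     of x; the event puts a sample point in it. *)
  have [z zc] : exists z, @grid_cell _ _ N (- B) h z c.
    apply: grid_cellP => // i.
    have := le_trans (ler_coord_norm c i) (KB _ Kc).
    by rewrite ler_norml => /andP[? ?]; apply/andP; split; lra.
  have zball y : grid_cell (- B) h z y -> K y /\ `|y - x| < delta * r n.
    by move=> zy; apply: cball; exact: grid_cell_diam (ltW h0) zy zc.
  have [i zi] := Acell w z Aw (fun y zy => (zball y zy).1).
  by exists i; rewrite distrC; exact: (zball _ zi).2.
have [A HA] := choice event.
exists A; split; first by move=> n; have [? []] := HA n.
apply: (@squeeze_cvge _ _ _ _ (fun n => (1 - Q * harmonic n)%:E) _ (fun=> 1%E)).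
- near=> n; have [mA [_ PA]] := HA n.
  rewrite PA ?probability_le1 //; near: n; [exact: nbhs_infty_ge|exact: r_range].
- apply: cvg_EFin; first by near=> n.
  rewrite -[X in _ --> X]subr0 -[X in _ --> _ - X](mulr0 Q).
  apply: cvgB; first exact: cvg_cst.
  by apply: cvgM; [exact: cvg_cst|exact: cvg_harmonic].
- exact: cvg_cst.
Unshelve. all: by end_near. Qed.
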